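(* Let $E$ be an arbitrary directed graph, let $G_E$ be its graph groupoid, and let $R$ be a commutative unital ring. Then the Leavitt path algebra $L_R(E)$ is isomorphic to the Steinberg algebra $A_R(G_E)$.
   Context: **Graphs.** A directed graph $E=(E^0,E^1,r_E,s_E)$ has vertex set $E^0$, edge set $E^1$ (no countability assumed) and range and source maps $r_E,s_E : E^1\to E^0$. A path is a sequence of edges $x=x_1x_2\cdots$ with $s_E(x_i)=r_E(x_{i+1})$; $|x|$ is its length, $r_E(x)=r_E(x_1)$, and for a finite path $s_E(x)=s_E(x_{|x|})$. Vertices are paths of length $0$ (with $r_E(v)=s_E(v)=v$). $E^*$ is the set of finite paths and $E^\infty$ the set of infinite paths. A source is a vertex $v$ with $r_E^{-1}(v)=\emptyset$; an infinite receiver is a vertex $v$ with $r_E^{-1}(v)$ infinite. **Graph groupoid.** Let $X := E^\infty\cup\{\mu\in E^* : s_E(\mu)\text{ is a source}\}\cup\{\mu\in E^* : s_E(\mu)\text{ is an infinite receiver}\}$ and $$G_E := \{(\alpha x,|\alpha|-|\beta|,\beta x) : \alpha,\beta\in E^*,\ x\in X,\ s_E(\alpha)=s_E(\beta)=r_E(x)\},$$ where $(x,k,y)$ has range $x$ and source $y$, $(x,k,y)(y,l,z)=(x,k+l,z)$, $(x,k,y)^{-1}=(y,-k,x)$, and the unit space $\{(x,0,x):x \in X\}$ is identified with $X$. For $\mu,\nu\in E^*$ with $s_E(\mu)=s_E(\nu)$ let $Z(\mu,\nu):=\{(\mu x,|\mu|-|\nu|,\nu x) : x\in X,\ s_E(\mu)=r_E(x)\}$,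 and for finite $F\subseteq E^*$ with $r_E(\alpha)=s_E(\mu)$ for all $\alpha\in F$ let $Z((\mu,\nu)\setminus F) := Z(\mu,\nu)\setminus\bigcup_{\alpha\in F}Z(\mu\alpha,\nu\alpha)$. The sets $Z((\mu,\nu)\setminus F)$ form a basis of compact open sets for a topology making $G_E$ a Hausdorff ample groupoid (an étale groupoid with a basis of compact open bisections, i.e. compact open sets on which range and source are homeomorphisms onto their images). **Steinberg algebra.** For a Hausdorff ample groupoid $G$, $A_R(G)$ is the $R$-algebra of locally constant functions $f : G\to R$ with compact support, with pointwise addition and convolution $(f*g)(\gamma)=\sum_{\alpha\beta=\gamma}f(\alpha)g(\beta)$. **Leavitt path algebra.** $L_R(E)$ is the universal $R$-algebra generated by elements $\{p_v : v\in E^0\}\cup\{s_e,s_{e^*} : e\in E^1\}$ such that: the $p_v$ are mutually orthogonal idempotents; $p_{r_E(e)}s_e=s_e=s_ep_{s_E(e)}$ and $p_{s_E(e)}s_{e^*}=s_{e^*}=s_{e^*}p_{r_E(e)}$ for $e\in E^1$; $s_{e^*}s_f=\delta_{e,f}\,p_{s_E(e)}$ for $e,f\in E^1$; and $p_v=\sum_{r_E(e)=v}s_es_{e^*}$ whenever $0<|r_E^{-1}(v)|<\infty$. *)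

(* Defs.v *)
From HB Require Import structures.
From mathcomp Require Import all_boot all_order all_algebra finmap.
From mathcomp Require Import all_classical.
From mathcomp Require Import topology.
From mathcomp Require Import ring zify.
Set Implicit Arguments.
Unset Strict Implicit.
Unset Printing Implicit Defensive.
Import Order.TTheory GRing.Theory Num.Theory.
Local Open Scope classical_set_scope.
Local Open Scope ring_scope.

(* Algebras over a commutative ring, associative but not necessarily unital:  *)
(* L_R(E) has a unit only when E has finitely many vertices.                  *)
HB.mixin Record Lmodule_isNuAlgebra (R : comPzRingType) V
    of GRing.Lmodule R V := {
  numul : V -> V -> V;
  numulA : associative numul;
  numulDl : left_distributive numul +%R;
  numulDr : right_distributive numul +%R;
  numulZl : forall (a : R) (x y : V), numul (a *: x) y = a *: numul x y;
  numulZr : forall (a : R) (x y : V), numul x (a *: y) = a *: numul x y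
}.

#[short(type="nuAlgType")]
HB.structure Definition NuAlgebra (R : comPzRingType) :=
  {V of Lmodule_isNuAlgebra R V & GRing.Lmodule R V}.

Reserved Notation "x ** y" (at level 40, left associativity).
Notation "x ** y" := (numul x y) : ring_scope.

(* Groupoids, as small categories with inverses.  The composition gmul is a   *)
(* total function, meaningful only on composable pairs (gsrc a = grng b).     *)
HB.mixin Record isGroupoid (G : Type) := {
  gunit : Type;
  grng : G -> gunit;
  gsrc : G -> gunit;
  gid : gunit -> G;
  ginv : G -> G;
  gmul : G -> G -> G;
  grng_id : forall u, grng (gid u) = u;
  gsrc_id : forall u, gsrc (gid u) = u;
  grng_inv : forall a, grng (ginv a) = gsrc a;
  gsrc_inv : forall a, gsrc (ginv a) = grng a;
  grng_mul : forall a b, gsrc a = grng b -> grng (gmul a b) = grng a;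
  gsrc_mul : forall a b, gsrc a = grng b -> gsrc (gmul a b) = gsrc b;
  gmulA : forall a b c, gsrc a = grng b -> gsrc b = grng c ->
    gmul a (gmul b c) = gmul (gmul a b) c;
  gmul_idl : forall a, gmul (gid (grng a)) a = a;
  gmul_idr : forall a, gmul a (gid (gsrc a)) = a;
  gmulVg : forall a, gmul (ginv a) a = gid (gsrc a);
  gmulgV : forall a, gmul a (ginv a) = gid (grng a)
}.

HB.structure Definition Groupoid := {G of isGroupoid G}.

(* A groupoid whose arrows carry a topology; no compatibility is required     *)
(* here, since none is needed to define the Steinberg algebra as a module.    *)
#[short(type="topGroupoidType")]
HB.structure Definition TopologicalGroupoid :=
  {G of Topological G & isGroupoid G}.

Definition locally_constant (T : topologicalType) (V : Type) (f : T -> V) :=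
  forall x, \forall y \near x, f y = f x.

Definition tsupport (T : topologicalType) (V : zmodType) (f : T -> V) : set T :=
  closure [set x | f x != 0].

Definition steinberg_fun (R : comPzRingType) (G : topGroupoidType) :
    set (G -> R^o) :=
  [set f | locally_constant f /\ compact (tsupport f)].

Arguments steinberg_fun : clear implicits.

Definition steinberg_pred (R : comPzRingType) (G : topGroupoidType) :
    {pred G -> R^o} :=
  [pred f | f \in steinberg_fun R G].

Arguments steinberg_pred : clear implicits.

Record steinberg (R : comPzRingType) (G : topGroupoidType) := Steinberg {
  steinberg_val :> G -> R^o;
  _ : steinberg_pred R G steinberg_val
}.

HB.instance Definition _ R G := [isSub for @steinberg_val R G].
HB.instance Definition _ R G := [Choice of steinberg R G by <:].

Lemma steinberg_submod_closed (R : comPzRingType) (G : topGroupoidType) :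
  submod_closed (steinberg_pred R G).
Proof.
split.
  rewrite !inE; split=> [x|]; first exact: filterE.
  rewrite /tsupport (_ : [set _ | _] = set0) ?closure0; first exact: compact0.
  by apply/seteqP; split=> x //=; rewrite eqxx.
move=> a f g; rewrite !inE => -[lf cf] [lg cg]; split=> [x|].
  near=> y.
  have -> : (a *: f + g) y = a *: f y + g y by [].
  have -> : (a *: f + g) x = a *: f x + g x by [].
  by congr (_ *: _ + _); near: y; [exact: lf|exact: lg].
apply: (@subclosed_compact _ _ (tsupport f `|` tsupport g)).
- exact: closed_closure.
- exact: compactU.
rewrite /tsupport -closureU; apply: closureS => x /=.
apply: contra_neqP => /not_orP[/negP/negPn/eqP fx0 /negP/negPn/eqP gx0].
have -> : (a *: f + g) x = a *: f x + g x by [].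
by rewrite fx0 gx0 scaler0 addr0.
Unshelve. all: by end_near.
Qed.

HB.instance Definition _ (R : comPzRingType) (G : topGroupoidType) :=
  GRing.SubChoice_isSubLmodule.Build R (G -> R^o) (steinberg_pred R G)
    (steinberg R G)
    (GRing.submod_closed_semi (@steinberg_submod_closed R G)).

(* The sum over [set p | ...] of a finitely supported family (it is 0 when    *)
(* the support is infinite); for f and g in A_R(G) the support is finite as   *)
(* soon as G is ample and Hausdorff.  Convolution is defined on all functions *)
(* because the closure of A_R(G) under it depends on G being ample.           *)
Definition convolution (R : comPzRingType) (G : topGroupoidType)
    (f g : G -> R^o) : G -> R^o := fun c =>
  \sum_(p \in [set p : G * G | gsrc p.1 = grng p.2 /\ gmul p.1 p.2 = c])
    (f p.1 * g p.2 : R).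

Record digraph := Digraph {
  vertex : Type;
  edge : Type;
  rng : edge -> vertex;
  src : edge -> vertex
}.

Arguments rng {E} e : rename.
Arguments src {E} e : rename.

(* Vertices and edges are arbitrary types; equality is decided classically.   *)
HB.instance Definition _ (E : digraph) := gen_eqMixin (vertex E).
HB.instance Definition _ (E : digraph) := gen_choiceMixin (vertex E).
HB.instance Definition _ (E : digraph) := gen_eqMixin (edge E).
HB.instance Definition _ (E : digraph) := gen_choiceMixin (edge E).

Definition received (E : digraph) (v : vertex E) : set (edge E) :=
  [set e | rng e = v].
Definition is_source (E : digraph) (v : vertex E) := received v = set0.
Definition infinite_receiver (E : digraph) (v : vertex E) :=
  infinite_set (received v).

(* A finite path is given by its range and its list of edges, so that the     *)
(* vertices are the paths (v, [::]).  fpath and gpath are raw data: the       *)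
(* composability of consecutive edges is imposed by finite_path and           *)
(* infinite_path.                                                             *)
Definition fpath (E : digraph) : Type := (vertex E * seq (edge E))%type.

HB.instance Definition _ (E : digraph) := Choice.on (fpath E).

Fixpoint path_from (E : digraph) (v : vertex E) (s : seq (edge E)) : Prop :=
  if s is e :: s' then rng e = v /\ path_from (src e) s' else True.

Definition finite_path (E : digraph) : set (fpath E) :=
  [set mu | path_from mu.1 mu.2].

Definition fpath_rng (E : digraph) (mu : fpath E) : vertex E := mu.1.
Definition fpath_src (E : digraph) (mu : fpath E) : vertex E :=
  last mu.1 (map src mu.2).
Definition fpath_len (E : digraph) (mu : fpath E) : nat := size mu.2.
Definition fpath_cat (E : digraph) (mu nu : fpath E) : fpath E :=
  (mu.1, mu.2 ++ nu.2).

Definition infinite_path (E : digraph) : set (nat -> edge E) :=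
  [set x | forall i, src (x i) = rng (x i.+1)].

Inductive gpath (E : digraph) :=
  | Fin of fpath E
  | Inf of (nat -> edge E).

Definition gpath_rng (E : digraph) (x : gpath E) : vertex E :=
  match x with Fin mu => fpath_rng mu | Inf y => rng (y 0%N) end.

Definition prepend (T : Type) (s : seq T) (y : nat -> T) : nat -> T :=
  foldr (fun e z n => if n is n'.+1 then z n' else e) y s.

Definition gpath_cat (E : digraph) (mu : fpath E) (x : gpath E) : gpath E :=
  match x with
  | Fin nu => Fin (fpath_cat mu nu)
  | Inf y => Inf (prepend mu.2 y)
  end.

(* The unit space of the graph groupoid: the infinite paths, and the finite   *)
(* paths ending at a source or at an infinite receiver.                       *)
Definition boundary_path (E : digraph) : set (gpath E) := [set x |
  match x with
  | Fin mu => finite_path mu /\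
      (is_source (fpath_src mu) \/ infinite_receiver (fpath_src mu))
  | Inf y => infinite_path y
  end].

Arguments finite_path : clear implicits.
Arguments boundary_path : clear implicits.

HB.instance Definition _ (E : digraph) := gen_eqMixin (gpath E).
HB.instance Definition _ (E : digraph) := gen_choiceMixin (gpath E).

Section paths.
Variable E : digraph.
Implicit Types (mu nu : fpath E) (x y : gpath E).

Lemma path_from_cat (v : vertex E) s t :
  path_from v (s ++ t) <-> path_from v s /\ path_from (last v (map src s)) t.
Proof.
elim: s v => [|e s IH] v /=; first by split=> [|[]].
rewrite IH; tauto.
Qed.

Lemma fpath_src_cat mu nu : fpath_src mu = fpath_rng nu ->
  fpath_src (fpath_cat mu nu) = fpath_src nu.
Proof. by rewrite /fpath_src/= map_cat last_cat => ->. Qed.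

Lemma finite_path_cat mu nu : finite_path E mu -> finite_path E nu ->
  fpath_src mu = fpath_rng nu -> finite_path E (fpath_cat mu nu).
Proof.
rewrite /finite_path/= => pm pn e; apply/path_from_cat; split=> //.
by move: e; rewrite /fpath_src => ->.
Qed.

Lemma fpath_catA mu nu ka :
  fpath_cat mu (fpath_cat nu ka) = fpath_cat (fpath_cat mu nu) ka.
Proof. by rewrite /fpath_cat/= catA. Qed.

Lemma fpath_len_cat mu nu :
  fpath_len (fpath_cat mu nu) = (fpath_len mu + fpath_len nu)%N.
Proof. by rewrite /fpath_len size_cat. Qed.

Lemma gpath_catA mu nu x :
  gpath_cat mu (gpath_cat nu x) = gpath_cat (fpath_cat mu nu) x.
Proof.
by case: x => [ka|y] /=; [rewrite fpath_catA | rewrite /prepend foldr_cat].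
Qed.

Lemma gpath_rng_cat mu x : finite_path E mu -> fpath_src mu = gpath_rng x ->
  gpath_rng (gpath_cat mu x) = fpath_rng mu.
Proof.
case: x => [//|y]; case: mu => v [|e s] /=; first by rewrite /fpath_src/= => _ ->.
by move=> [-> _] _.
Qed.

Lemma boundary_path_cat mu x : finite_path E mu -> boundary_path E x ->
  fpath_src mu = gpath_rng x -> boundary_path E (gpath_cat mu x).
Proof.
case: x => [nu|y] pm /=; last first.
  move=> py; case: mu pm => v s /=.
  rewrite /finite_path/= /fpath_src/=.
  elim: s v => [|e s IH] v //= [ev ps] sy [|i] /=; last exact: (IH (src e)).
  by case: s ps sy {IH} => [|f s] //= [].
move=> [pn Hn] e; split; last by rewrite fpath_src_cat.
exact: finite_path_cat.
Qed.

Lemma boundary_path_vertex_cat (v : vertex E) x : v = gpath_rng x ->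
  gpath_cat (v, [::]) x = x.
Proof. by case: x => [[w s]|y] //= ->. Qed.

Lemma gpath_cat_inj mu x y : gpath_rng x = gpath_rng y ->
  gpath_cat mu x = gpath_cat mu y -> x = y.
Proof.
case: x y => [[v s]|x] [[w t]|y] //= r.
  rewrite /fpath_cat => -[] /= /eqP; rewrite eqseq_cat// eqxx/= => /eqP ->.
  by move: r; rewrite /fpath_rng/= => ->.
move=> [] H; congr Inf; elim: (mu.2) H => [//|e s IH] /= H.
by apply: IH; apply/funext => i; have := congr1 (@^~ i.+1) H.
Qed.

Lemma gpath_cat_prefix mu nu x y : finite_path E mu -> finite_path E nu ->
  fpath_src mu = gpath_rng x -> fpath_src nu = gpath_rng y ->
  gpath_cat mu x = gpath_cat nu y -> (fpath_len mu <= fpath_len nu)%N ->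
  exists la, [/\ finite_path E la, fpath_rng la = fpath_src mu,
    nu = fpath_cat mu la & x = gpath_cat la y].
Proof.
move=> pm pn mx ny e le.
have r : mu.1 = nu.1.
  by have /= := congr1 (@gpath_rng E) e; rewrite !gpath_rng_cat.
have t : nu.2 = mu.2 ++ drop (fpath_len mu) nu.2.
  case: x y mx ny e => [[v s]|x] [[w t]|y] //= _ _.
    rewrite /fpath_cat => -[_ /= e].
    have := congr1 (take (fpath_len mu)) e.
    rewrite take_size_cat// takel_cat// => {1}->.
    by rewrite cat_take_drop.
  move=> [e]; move: le; rewrite /fpath_len.
  elim: (mu.2) (nu.2) e => [|a s IH] [|b t] //= e le.
  have /= := congr1 (@^~ 0%N) e => <-; congr cons; apply: IH => //.
  by apply/funext => i; have := congr1 (@^~ i.+1) e.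
pose la : fpath E := (fpath_src mu, drop (fpath_len mu) nu.2).
have nuE : nu = fpath_cat mu la.
  by rewrite /fpath_cat /la/= -t r; case: (nu).
have pl : finite_path E la.
  by move: pn; rewrite nuE => /path_from_cat[].
exists la; split=> //.
have ly : fpath_src la = gpath_rng y by rewrite -ny nuE fpath_src_cat.
apply: (@gpath_cat_inj mu); first by rewrite gpath_rng_cat.
by rewrite e nuE gpath_catA.
Qed.

Lemma fpath_cat_injr mu nu ka : fpath_rng nu = fpath_rng ka ->
  fpath_cat mu nu = fpath_cat mu ka -> nu = ka.
Proof.
case: nu ka => [v s] [w t]; rewrite /fpath_rng/= => -> [] /eqP.
by rewrite eqseq_cat// eqxx/= => /eqP ->.
Qed.

End paths.

Definition graph_groupoid_elt (E : digraph) : set (gpath E * int * gpath E) :=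
  [set g | exists (al be : fpath E) (x : gpath E),
    [/\ finite_path E al, finite_path E be, boundary_path E x,
        fpath_src al = gpath_rng x /\ fpath_src be = gpath_rng x &
        g = (gpath_cat al x, (fpath_len al)%:Z - (fpath_len be)%:Z,
             gpath_cat be x)]].

Arguments graph_groupoid_elt : clear implicits.

Record graph_groupoid (E : digraph) := GraphGroupoid {
  gg_val :> gpath E * int * gpath E;
  gg_valP : graph_groupoid_elt E gg_val
}.

HB.instance Definition _ (E : digraph) := gen_eqMixin (graph_groupoid E).
HB.instance Definition _ (E : digraph) := gen_choiceMixin (graph_groupoid E).

Section graph_groupoid.
Variable E : digraph.
Implicit Types (g h : graph_groupoid E) (u : boundary_path E).

Lemma gg_val_inj : injective (@gg_val E).
Proof.
by case=> a pa [b pb] /= eab; subst b; congr GraphGroupoid; exact: Prop_irrelevance.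
Qed.

Lemma gg_rng_proof g : g.1.1 \in boundary_path E.
Proof.
case: g => z /= [al [be [x [? ? ? [? ?] ->]]]]; rewrite inE.
exact: boundary_path_cat.
Qed.

Lemma gg_src_proof g : g.2 \in boundary_path E.
Proof.
case: g => z /= [al [be [x [? ? ? [? ?] ->]]]]; rewrite inE.
exact: boundary_path_cat.
Qed.

Definition gg_rng g : boundary_path E := exist _ g.1.1 (gg_rng_proof g).
Definition gg_src g : boundary_path E := exist _ g.2 (gg_src_proof g).

Lemma gg_id_proof u : graph_groupoid_elt E (val u, 0, val u).
Proof.
case: u => x /= /set_mem bx.
exists (gpath_rng x, [::]), (gpath_rng x, [::]), x; split=> //.
by rewrite boundary_path_vertex_cat ?subrr.
Qed.

Definition gg_id u := GraphGroupoid (gg_id_proof u).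

Lemma gg_inv_proof g : graph_groupoid_elt E (g.2, - g.1.2, g.1.1).
Proof.
case: g => z /= [al [be [x [? ? ? [? ?] ->]]]] /=.
by exists be, al, x; split=> //; rewrite opprB.
Qed.

Definition gg_inv g := GraphGroupoid (gg_inv_proof g).

Lemma gg_mul_proof g h : g.2 = h.1.1 ->
  graph_groupoid_elt E (g.1.1, g.1.2 + h.1.2, h.2).
Proof.
case: g => z /= [al [be [x [pal pbe bx [alx bex] ->]]]] /=.
case: h => z' /= [ga [de [y [pga pde By [gay dey] ->]]]] /= e.
have [le|/ltnW le] := leqP (fpath_len be) (fpath_len ga).
  have [la [pl lb gaE xE]] := gpath_cat_prefix pbe pga bex gay e le.
  have all : fpath_src al = fpath_rng la by rewrite lb alx bex.
  exists (fpath_cat al la), de, y; split=> //.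
  - exact: finite_path_cat.
  - by rewrite fpath_src_cat//; split=> //; rewrite -gay gaE fpath_src_cat.
  rewrite xE gpath_catA gaE !fpath_len_cat !PoszD; congr (_, _, _).
  by ring.
have [la [pl lb beE yE]] := gpath_cat_prefix pga pbe gay bex (esym e) le.
have del : fpath_src de = fpath_rng la by rewrite lb dey gay.
exists al, (fpath_cat de la), x; split=> //.
- exact: finite_path_cat.
- by rewrite fpath_src_cat//; split=> //; rewrite -bex beE fpath_src_cat.
rewrite yE gpath_catA beE !fpath_len_cat !PoszD; congr (_, _, _).
by ring.
Qed.

Definition gg_mul g h : graph_groupoid E :=
  if pselect (g.2 = h.1.1) is left e then GraphGroupoid (gg_mul_proof e) else g.

Lemma gg_src_rngP g h : gg_src g = gg_rng h <-> g.2 = h.1.1.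
Proof.
split=> [/(congr1 val)//|e]; exact/val_inj.
Qed.

Lemma gg_mulE g h : gg_src g = gg_rng h ->
  gg_val (gg_mul g h) = (g.1.1, g.1.2 + h.1.2, h.2).
Proof. by rewrite gg_src_rngP /gg_mul; case: pselect. Qed.

Lemma gg_ext g h : g.1.1 = h.1.1 -> g.1.2 = h.1.2 -> g.2 = h.2 -> g = h.
Proof.
move=> e1 e2 e3; apply: gg_val_inj.
by move: e1 e2 e3; case: (gg_val g) (gg_val h) => [[? ?] ?] [[? ?] ?] /= -> -> ->.
Qed.

Lemma gg_rng_id u : gg_rng (gg_id u) = u. Proof. exact/val_inj. Qed.

Lemma gg_src_id u : gg_src (gg_id u) = u. Proof. exact/val_inj. Qed.

Lemma gg_rng_inv g : gg_rng (gg_inv g) = gg_src g.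
Proof. exact/val_inj. Qed.

Lemma gg_src_inv g : gg_src (gg_inv g) = gg_rng g.
Proof. exact/val_inj. Qed.

Lemma gg_rng_mul g h : gg_src g = gg_rng h -> gg_rng (gg_mul g h) = gg_rng g.
Proof. by move=> e; apply/val_inj; rewrite /= gg_mulE. Qed.

Lemma gg_src_mul g h : gg_src g = gg_rng h -> gg_src (gg_mul g h) = gg_src h.
Proof. by move=> e; apply/val_inj; rewrite /= gg_mulE. Qed.

Lemma gg_mulA g h k : gg_src g = gg_rng h -> gg_src h = gg_rng k ->
  gg_mul g (gg_mul h k) = gg_mul (gg_mul g h) k.
Proof.
move=> gh hk; apply: gg_val_inj.
rewrite !gg_mulE ?gg_rng_mul ?gg_src_mul//=.
by rewrite addrA.
Qed.

Lemma gg_mul_idl g : gg_mul (gg_id (gg_rng g)) g = g.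
Proof.
by apply: gg_ext; rewrite gg_mulE ?gg_src_id//= add0r.
Qed.

Lemma gg_mul_idr g : gg_mul g (gg_id (gg_src g)) = g.
Proof.
by apply: gg_ext; rewrite gg_mulE ?gg_rng_id//= addr0.
Qed.

Lemma gg_mulVg g : gg_mul (gg_inv g) g = gg_id (gg_src g).
Proof.
by apply: gg_ext; rewrite gg_mulE ?gg_src_inv//= addNr.
Qed.

Lemma gg_mulgV g : gg_mul g (gg_inv g) = gg_id (gg_rng g).
Proof.
by apply: gg_ext; rewrite gg_mulE ?gg_rng_inv//= subrr.
Qed.

HB.instance Definition _ := isGroupoid.Build (graph_groupoid E)
  gg_rng_id gg_src_id gg_rng_inv gg_src_inv gg_rng_mul gg_src_mul gg_mulA
  gg_mul_idl gg_mul_idr gg_mulVg gg_mulgV.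

(* Z(mu,nu), and Z((mu,nu) \ F) below; only used when mu and nu have the same *)
(* source.                                                                    *)
Definition cylinder (mu nu : fpath E) : set (graph_groupoid E) :=
  [set g | exists x, [/\ boundary_path E x, fpath_src mu = gpath_rng x &
    gg_val g = (gpath_cat mu x, (fpath_len mu)%:Z - (fpath_len nu)%:Z,
                gpath_cat nu x)]].

Definition cylinderD (mu nu : fpath E) (F : set (fpath E)) :
    set (graph_groupoid E) :=
  cylinder mu nu `\`
    \bigcup_(al in F) cylinder (fpath_cat mu al) (fpath_cat nu al).

Definition basic_sets : set (set (graph_groupoid E)) :=
  [set B | exists mu nu F,
    [/\ finite_path E mu /\ finite_path E nu, fpath_src mu = fpath_src nu,
        finite_set F,
        F `<=` [set al | finite_path E al /\ fpath_rng al = fpath_src mu] &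
        B = cylinderD mu nu F]].

Lemma cylinder_cat mu nu la : finite_path E la ->
  fpath_rng la = fpath_src mu -> fpath_rng la = fpath_src nu ->
  cylinder (fpath_cat mu la) (fpath_cat nu la) `<=` cylinder mu nu.
Proof.
move=> pl lm ln g [x [bx]]; rewrite fpath_src_cat// => lx e.
exists (gpath_cat la x); split.
- exact: boundary_path_cat.
- by rewrite gpath_rng_cat.
rewrite e !gpath_catA !fpath_len_cat !PoszD; congr (_, _, _); ring.
Qed.

Lemma cylinder_nested mu nu mu' nu' g :
  finite_path E mu -> finite_path E nu -> fpath_src mu = fpath_src nu ->
  finite_path E mu' -> finite_path E nu' -> fpath_src mu' = fpath_src nu' ->
  cylinder mu nu g -> cylinder mu' nu' g ->
  (fpath_len mu <= fpath_len mu')%N ->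
  exists la, [/\ finite_path E la, fpath_rng la = fpath_src mu,
    mu' = fpath_cat mu la & nu' = fpath_cat nu la].
Proof.
move=> pm pn mn pm' pn' mn' [x [bx mx e]] [y [By my]].
rewrite e => -[e1 e2 e3] le.
have [la [pl lm me xe]] := gpath_cat_prefix pm pm' mx my e1 le.
have nx : fpath_src nu = gpath_rng x by rewrite -mn.
have ny : fpath_src nu' = gpath_rng y by rewrite -mn'.
have le' : (fpath_len nu <= fpath_len nu')%N.
  move: e2 => /eqP; rewrite me fpath_len_cat => /eqP; lia.
have [ka [pk kn ne xe']] := gpath_cat_prefix pn pn' nx ny e3 le'.
have lk : (fpath_len la <= fpath_len ka)%N.
  by move: e2; rewrite me ne !fpath_len_cat; lia.
have ly : fpath_src la = gpath_rng y.
  by rewrite -my me fpath_src_cat.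
have ky : fpath_src ka = gpath_rng y.
  by rewrite -ny ne fpath_src_cat.
have [om [po ol ke ye]] := gpath_cat_prefix pl pk ly ky (etrans (esym xe) xe') lk.
have o0 : om.2 = [::].
  apply: size0nil; move: e2.
  by rewrite me ne ke !fpath_len_cat -/(fpath_len om); lia.
exists la; split=> //; rewrite ne ke /fpath_cat/= o0 cats0 //.
Qed.

Lemma basic_sets_cover : \bigcup_(B in basic_sets) B = setT.
Proof.
apply/seteqP; split=> // g _.
have [al [be [x [pa pb bx [ax bex] e]]]] := gg_valP g.
exists (cylinderD al be set0).
  exists al, be, set0; split=> //; first by rewrite ax bex.
by split; [exists x | case].
Qed.

Lemma cylinderD_le mu nu F mu' nu' F' g :
  finite_path E mu -> finite_path E nu -> fpath_src mu = fpath_src nu ->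
  finite_set F ->
  F `<=` [set al | finite_path E al /\ fpath_rng al = fpath_src mu] ->
  finite_path E mu' -> finite_path E nu' -> fpath_src mu' = fpath_src nu' ->
  finite_set F' ->
  F' `<=` [set al | finite_path E al /\ fpath_rng al = fpath_src mu'] ->
  cylinderD mu nu F g -> cylinderD mu' nu' F' g ->
  (fpath_len mu <= fpath_len mu')%N ->
  exists B, [/\ basic_sets B, B g &
    B `<=` cylinderD mu nu F `&` cylinderD mu' nu' F'].
Proof.
move=> pm pn mn fF FS pm' pn' mn' fF' FS' [gm gF] [gm' gF'] le.
have [la [pl lm me ne]] := cylinder_nested pm pn mn pm' pn' mn' gm gm' le.
have ln : fpath_rng la = fpath_src nu by rewrite lm.
have lm' : fpath_src mu' = fpath_src la by rewrite me fpath_src_cat.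
pose F0 := [set al | [/\ finite_path E al, fpath_rng al = fpath_src mu' &
                      F (fpath_cat la al)]].
have laF al : fpath_rng al = fpath_src mu' ->
    fpath_cat mu' al = fpath_cat mu (fpath_cat la al) /\
    fpath_cat nu' al = fpath_cat nu (fpath_cat la al).
  by rewrite me ne !fpath_catA.
exists (cylinderD mu' nu' (F0 `|` F')); split.
- exists mu', nu', (F0 `|` F'); split=> //; last first.
    by move=> al [[]|/FS'].
  rewrite finite_setU; split=> //.
  apply: (@sub_finite_set _ _
    ((fun al : fpath E => (fpath_src mu', drop (fpath_len la) al.2)) @` F)).
    move=> [v s] [/= _ vE Fs]; exists (fpath_cat la (v, s)) => //=.
    by rewrite drop_size_cat// -vE.
  exact: finite_image.
- split=> // -[al [[pa ra Fa]|Fa]] ga; last by apply: gF'; exists al.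
  by apply: gF; exists (fpath_cat la al) => //; case: (laF al ra) => <- <-.
move=> h [hm' hF]; split; split.
- by move: hm'; rewrite me ne; exact: cylinder_cat.
- move=> [al Fa ha]; have [pa ra] := FS al Fa.
  have ra' : fpath_rng al = fpath_src nu by rewrite ra.
  have pma := finite_path_cat pm pa (esym ra).
  have pna := finite_path_cat pn pa (esym ra').
  have mna : fpath_src (fpath_cat mu al) = fpath_src (fpath_cat nu al).
    by rewrite !fpath_src_cat.
  have [le1|/ltnW le1] := leqP (fpath_len (fpath_cat mu al)) (fpath_len mu').
    have [ka [pk km e1 e2]] :=
      cylinder_nested pma pna mna pm' pn' mn' ha hm' le1.
    apply: gF; exists al => //.
    by move: gm'; rewrite e1 e2; apply: cylinder_cat; rewrite // -mna.
  have [ka [pk km e1 e2]] :=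
    cylinder_nested pm' pn' mn' pma pna mna hm' ha le1.
  apply: hF; exists ka; last by rewrite -e1 -e2.
  left; split=> //; suff -> : fpath_cat la ka = al by [].
  apply: (@fpath_cat_injr _ mu); first by rewrite ra.
  by case: (laF ka km) => <- _; rewrite e1.
- by [].
- by move=> [al Fa ha]; apply: hF; exists al => //; right.
Qed.

Lemma basic_sets_join B C g : basic_sets B -> basic_sets C -> B g -> C g ->
  exists D, [/\ basic_sets D, D g & D `<=` B `&` C].
Proof.
move=> [mu [nu [F [[pm pn] mn fF FS ->]]]] [mu' [nu' [F' [[pm' pn'] mn' fF' FS' ->]]]].
move=> gB gC; have [le|/ltnW le] := leqP (fpath_len mu) (fpath_len mu').
  exact: (cylinderD_le pm pn mn fF FS pm' pn' mn' fF' FS').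
have [D [bD Dg sD]] :=
  cylinderD_le pm' pn' mn' fF' FS' pm pn mn fF FS gC gB le.
by exists D; split=> //; rewrite setIC.
Qed.

HB.instance Definition _ := isBaseTopological.Build (graph_groupoid E)
  basic_sets_cover basic_sets_join.

End graph_groupoid.

HB.instance Definition _ (E : digraph) := TopologicalGroupoid.on (graph_groupoid E).

(* The defining relations, for a family in a not necessarily unital algebra;  *)
(* t e stands for the generator of the ghost edge of e.                       *)
Definition leavitt_family (R : comPzRingType) (E : digraph)
    (A : nuAlgType R) (p : vertex E -> A) (s t : edge E -> A) : Prop :=
  [/\ forall v w, p v ** p w = if v == w then p v else 0,
      forall e, p (rng e) ** s e = s e /\ s e ** p (src e) = s e,
      forall e, p (src e) ** t e = t e /\ t e ** p (rng e) = t e,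
      forall e f, t e ** s f = if e == f then p (src e) else 0 &
      forall v, received v !=set0 -> finite_set (received v) ->
        p v = \sum_(e \in received v) s e ** t e].

(* Formal expressions in the generators, and the least congruence imposing    *)
(* the axioms of an R-algebra and the defining relations.                     *)
Inductive lpa_term (R : comPzRingType) (E : digraph) : Type :=
  | TVertex of vertex E
  | TEdge of edge E
  | TGhost of edge E
  | TZero
  | TAdd of lpa_term R E & lpa_term R E
  | TOpp of lpa_term R E
  | TScale of R & lpa_term R E
  | TMul of lpa_term R E & lpa_term R E.

Arguments TVertex {R E}.
Arguments TEdge {R E}.
Arguments TGhost {R E}.
Arguments TZero {R E}.

Inductive lpa_eq (R : comPzRingType) (E : digraph) :
    lpa_term R E -> lpa_term R E -> Prop :=
  | lpa_refl x : lpa_eq x x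
  | lpa_sym x y : lpa_eq x y -> lpa_eq y x
  | lpa_trans x y z : lpa_eq x y -> lpa_eq y z -> lpa_eq x z
  | lpa_congD x x' y y' : lpa_eq x x' -> lpa_eq y y' ->
      lpa_eq (TAdd x y) (TAdd x' y')
  | lpa_congN x x' : lpa_eq x x' -> lpa_eq (TOpp x) (TOpp x')
  | lpa_congZ a x x' : lpa_eq x x' -> lpa_eq (TScale a x) (TScale a x')
  | lpa_congM x x' y y' : lpa_eq x x' -> lpa_eq y y' ->
      lpa_eq (TMul x y) (TMul x' y')
  | lpa_addA x y z : lpa_eq (TAdd x (TAdd y z)) (TAdd (TAdd x y) z)
  | lpa_addC x y : lpa_eq (TAdd x y) (TAdd y x)
  | lpa_add0 x : lpa_eq (TAdd TZero x) x
  | lpa_addN x : lpa_eq (TAdd (TOpp x) x) TZero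
  | lpa_scaleA a b x : lpa_eq (TScale a (TScale b x)) (TScale (a * b) x)
  | lpa_scale1 x : lpa_eq (TScale 1 x) x
  | lpa_scaleDr a x y :
      lpa_eq (TScale a (TAdd x y)) (TAdd (TScale a x) (TScale a y))
  | lpa_scaleDl x a b :
      lpa_eq (TScale (a + b) x) (TAdd (TScale a x) (TScale b x))
  | lpa_mulA x y z : lpa_eq (TMul x (TMul y z)) (TMul (TMul x y) z)
  | lpa_mulDl x y z : lpa_eq (TMul (TAdd x y) z) (TAdd (TMul x z) (TMul y z))
  | lpa_mulDr x y z : lpa_eq (TMul x (TAdd y z)) (TAdd (TMul x y) (TMul x z))
  | lpa_mulZl a x y : lpa_eq (TMul (TScale a x) y) (TScale a (TMul x y))
  | lpa_mulZr a x y : lpa_eq (TMul x (TScale a y)) (TScale a (TMul x y))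
  | lpa_vertex_idem v : lpa_eq (TMul (TVertex v) (TVertex v)) (TVertex v)
  | lpa_vertex_orth v w : v <> w ->
      lpa_eq (TMul (TVertex v) (TVertex w)) TZero
  | lpa_rng_edge e : lpa_eq (TMul (TVertex (rng e)) (TEdge e)) (TEdge e)
  | lpa_edge_src e : lpa_eq (TMul (TEdge e) (TVertex (src e))) (TEdge e)
  | lpa_src_ghost e : lpa_eq (TMul (TVertex (src e)) (TGhost e)) (TGhost e)
  | lpa_ghost_rng e : lpa_eq (TMul (TGhost e) (TVertex (rng e))) (TGhost e)
  | lpa_ghost_edge e : lpa_eq (TMul (TGhost e) (TEdge e)) (TVertex (src e))
  | lpa_ghost_edge0 e f : e <> f -> lpa_eq (TMul (TGhost e) (TEdge f)) TZero
  | lpa_ck2 v : received v !=set0 -> finite_set (received v) ->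
      lpa_eq (TVertex v)
        (foldr (fun e x => TAdd (TMul (TEdge e) (TGhost e)) x) TZero
          (fset_set (received v))).

HB.instance Definition _ R E := gen_eqMixin (lpa_term R E).
HB.instance Definition _ R E := gen_choiceMixin (lpa_term R E).

Definition lpa_rel (R : comPzRingType) (E : digraph) : rel (lpa_term R E) :=
  fun x y => `[< lpa_eq x y >].

Lemma lpa_rel_equiv (R : comPzRingType) (E : digraph) :
  equiv_class_of (@lpa_rel R E).
Proof.
split=> [x|x y|y x z]; first by apply/asboolP; exact: lpa_refl.
  by apply/asboolP/asboolP => ?; exact: lpa_sym.
by move=> /asboolP xy /asboolP yz; apply/asboolP; exact: lpa_trans xy yz.
Qed.

Canonical lpa_equiv_rel (R : comPzRingType) (E : digraph) :=
  EquivRelPack (@lpa_rel_equiv R E).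

Definition leavitt_path_algebra (R : comPzRingType) (E : digraph) : Type :=
  {eq_quot @lpa_equiv_rel R E}%qT.

HB.instance Definition _ R E :=
  Choice.copy (leavitt_path_algebra R E) {eq_quot @lpa_equiv_rel R E}%qT.

Section leavitt_path_algebra.
Variables (R : comPzRingType) (E : digraph).
Notation L := (leavitt_path_algebra R E).
Notation T := (lpa_term R E).
Implicit Types (x y z : L) (a b : R) (t u : T).

Definition lpa_class (t : T) : L :=
  (\pi_({eq_quot @lpa_equiv_rel R E}))%qT t.
Definition lpa_repr (x : L) : T :=
  generic_quotient.repr (x : {eq_quot @lpa_equiv_rel R E}%qT).

Lemma lpa_classP t u : lpa_class t = lpa_class u <-> lpa_eq t u.
Proof.
split=> [H|H]; last by apply/eqquotP/asboolP.
by apply/asboolP; move/eqquotP : H.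
Qed.

Lemma lpa_reprK x : lpa_class (lpa_repr x) = x. Proof. exact: reprK. Qed.

Lemma lpa_repr_class t : lpa_eq (lpa_repr (lpa_class t)) t.
Proof. by apply/lpa_classP; exact: lpa_reprK. Qed.

Lemma lpa_ind (P : L -> Prop) : (forall t, P (lpa_class t)) -> forall x, P x.
Proof. by move=> H x; rewrite -(lpa_reprK x); exact: H. Qed.

Definition lpa_add x y := lpa_class (TAdd (lpa_repr x) (lpa_repr y)).
Definition lpa_opp x := lpa_class (TOpp (lpa_repr x)).
Definition lpa_scale a x := lpa_class (TScale a (lpa_repr x)).
Definition lpa_mul x y := lpa_class (TMul (lpa_repr x) (lpa_repr y)).

Lemma lpa_addE t u :
  lpa_add (lpa_class t) (lpa_class u) = lpa_class (TAdd t u).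
Proof. by apply/lpa_classP; apply: lpa_congD; exact: lpa_repr_class. Qed.

Lemma lpa_oppE t : lpa_opp (lpa_class t) = lpa_class (TOpp t).
Proof. by apply/lpa_classP; apply: lpa_congN; exact: lpa_repr_class. Qed.

Lemma lpa_scaleE a t : lpa_scale a (lpa_class t) = lpa_class (TScale a t).
Proof. by apply/lpa_classP; apply: lpa_congZ; exact: lpa_repr_class. Qed.

Lemma lpa_mulE t u :
  lpa_mul (lpa_class t) (lpa_class u) = lpa_class (TMul t u).
Proof. by apply/lpa_classP; apply: lpa_congM; exact: lpa_repr_class. Qed.

Let lpaE := (lpa_addE, lpa_oppE, lpa_scaleE, lpa_mulE).

Fact lpa_addrA : associative lpa_add.
Proof.
do 3![elim/lpa_ind => ?]; rewrite !lpaE; apply/lpa_classP; exact: lpa_addA.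
Qed.

Fact lpa_addrC : commutative lpa_add.
Proof.
do 2![elim/lpa_ind => ?]; rewrite !lpaE; apply/lpa_classP; exact: lpa_addC.
Qed.

Fact lpa_add0r : left_id (lpa_class TZero) lpa_add.
Proof. elim/lpa_ind => ?; rewrite !lpaE; apply/lpa_classP; exact: lpa_add0. Qed.

Fact lpa_addNr : left_inverse (lpa_class TZero) lpa_opp lpa_add.
Proof. elim/lpa_ind => ?; rewrite !lpaE; apply/lpa_classP; exact: lpa_addN. Qed.

HB.instance Definition _ := GRing.isZmodule.Build L
  lpa_addrA lpa_addrC lpa_add0r lpa_addNr.

Fact lpa_scalerA a b x : lpa_scale a (lpa_scale b x) = lpa_scale (a * b) x.
Proof.
elim/lpa_ind: x => ?; rewrite !lpaE; apply/lpa_classP; exact: lpa_scaleA.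
Qed.

Fact lpa_scale1r : left_id 1 lpa_scale.
Proof.
elim/lpa_ind => ?; rewrite !lpaE; apply/lpa_classP; exact: lpa_scale1.
Qed.

Fact lpa_scalerDr : right_distributive lpa_scale +%R.
Proof.
move=> a; do 2![elim/lpa_ind => ?].
rewrite /GRing.add/= !lpaE; apply/lpa_classP; exact: lpa_scaleDr.
Qed.

Fact lpa_scalerDl x : {morph lpa_scale^~ x : a b / a + b}.
Proof.
elim/lpa_ind: x => ? a b.
rewrite [in RHS]/GRing.add/= !lpaE; apply/lpa_classP; exact: lpa_scaleDl.
Qed.

HB.instance Definition _ := GRing.Zmodule_isLmodule.Build R L
  lpa_scalerA lpa_scale1r lpa_scalerDr lpa_scalerDl.

Fact lpa_mulrA : associative lpa_mul.
Proof.
do 3![elim/lpa_ind => ?]; rewrite !lpaE; apply/lpa_classP; exact: lpa_mulA.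
Qed.

Fact lpa_mulrDl : left_distributive lpa_mul +%R.
Proof.
do 3![elim/lpa_ind => ?]; rewrite /GRing.add/= !lpaE; apply/lpa_classP.
exact: lpa_mulDl.
Qed.

Fact lpa_mulrDr : right_distributive lpa_mul +%R.
Proof.
do 3![elim/lpa_ind => ?]; rewrite /GRing.add/= !lpaE; apply/lpa_classP.
exact: lpa_mulDr.
Qed.

Fact lpa_mulrZl a x y : lpa_mul (a *: x) y = a *: lpa_mul x y.
Proof.
move: x y; do 2![elim/lpa_ind => ?].
rewrite /GRing.scale/= !lpaE; apply/lpa_classP; exact: lpa_mulZl.
Qed.

Fact lpa_mulrZr a x y : lpa_mul x (a *: y) = a *: lpa_mul x y.
Proof.
move: x y; do 2![elim/lpa_ind => ?].
rewrite /GRing.scale/= !lpaE; apply/lpa_classP; exact: lpa_mulZr.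
Qed.

HB.instance Definition _ := Lmodule_isNuAlgebra.Build R L
  lpa_mulrA lpa_mulrDl lpa_mulrDr lpa_mulrZl lpa_mulrZr.

Definition lpa_p (v : vertex E) : L := lpa_class (TVertex v).
Definition lpa_s (e : edge E) : L := lpa_class (TEdge e).
Definition lpa_t (e : edge E) : L := lpa_class (TGhost e).

Lemma lpa_class0 : lpa_class TZero = 0. Proof. by []. Qed.
Lemma lpa_classD t u : lpa_class (TAdd t u) = lpa_class t + lpa_class u.
Proof. by rewrite -lpa_addE. Qed.
Lemma lpa_classN t : lpa_class (TOpp t) = - lpa_class t.
Proof. by rewrite -lpa_oppE. Qed.
Lemma lpa_classZ a t : lpa_class (TScale a t) = a *: lpa_class t.
Proof. by rewrite -lpa_scaleE. Qed.
Lemma lpa_classM t u : lpa_class (TMul t u) = lpa_class t ** lpa_class u.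
Proof. by rewrite -lpa_mulE. Qed.

Lemma lpa_leavitt_family : leavitt_family lpa_p lpa_s lpa_t.
Proof.
split=> [v w|e|e|e f|v v0 fv].
- rewrite -lpa_classM; case: eqVneq => [->|/eqP vw]; apply/lpa_classP.
    exact: lpa_vertex_idem.
  exact: lpa_vertex_orth.
- by rewrite -!lpa_classM; split; apply/lpa_classP;
    [exact: lpa_rng_edge|exact: lpa_edge_src].
- by rewrite -!lpa_classM; split; apply/lpa_classP;
    [exact: lpa_src_ghost|exact: lpa_ghost_rng].
- rewrite -lpa_classM; case: eqVneq => [->|/eqP ef]; apply/lpa_classP.
    exact: lpa_ghost_edge.
  exact: lpa_ghost_edge0.
transitivity (lpa_class (foldr
    (fun e (t : T) => TAdd (TMul (TEdge e) (TGhost e)) t) TZero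
    (fset_set (received v)))).
  by apply/lpa_classP; exact: lpa_ck2.
rewrite fsbig_finite//=.
elim: (fset_set _ : seq _) => [|e l IH] /=; first by rewrite big_nil.
by rewrite lpa_classD lpa_classM IH big_cons.
Qed.

End leavitt_path_algebra.

(* leavitt_path_algebra R E is the universal algebra with such a family.      *)
Section universal_property.
Variables (R : comPzRingType) (E : digraph) (A : nuAlgType R).
Variables (p : vertex E -> A) (s t : edge E -> A).
Hypothesis pst : leavitt_family p s t.

Fixpoint lpa_eval (x : lpa_term R E) : A :=
  match x with
  | TVertex v => p v
  | TEdge e => s e
  | TGhost e => t e
  | TZero => 0
  | TAdd x y => lpa_eval x + lpa_eval y
  | TOpp x => - lpa_eval x
  | TScale a x => a *: lpa_eval x
  | TMul x y => lpa_eval x ** lpa_eval y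
  end.

Lemma lpa_eval_eq x y : lpa_eq x y -> lpa_eval x = lpa_eval y.
Proof.
have [pp ps pt ts ck] := pst.
elim=> //=; try by move=> *; congruence.
- by move=> *; rewrite addrA.
- by move=> *; rewrite addrC.
- by move=> *; rewrite add0r.
- by move=> *; rewrite addNr.
- by move=> *; rewrite scalerA.
- by move=> *; rewrite scale1r.
- by move=> *; rewrite scalerDr.
- by move=> *; rewrite scalerDl.
- by move=> *; rewrite numulA.
- by move=> *; rewrite numulDl.
- by move=> *; rewrite numulDr.
- by move=> *; rewrite numulZl.
- by move=> *; rewrite numulZr.
- by move=> v; rewrite pp eqxx.
- by move=> v w /eqP/negPf vw; rewrite pp vw.
- by move=> e; case: (ps e).
- by move=> e; case: (ps e).
- by move=> e; case: (pt e).
- by move=> e; case: (pt e).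
- by move=> e; rewrite ts eqxx.
- by move=> e f /eqP/negPf ef; rewrite ts ef.
move=> v v0 fv; rewrite ck// fsbig_finite//=.
by elim: (fset_set _ : seq _) => [|e l IH] /=; rewrite ?big_nil// big_cons IH.
Qed.

Definition lpa_lift (x : leavitt_path_algebra R E) : A := lpa_eval (lpa_repr x).

Lemma lpa_liftE x : lpa_lift (lpa_class x) = lpa_eval x.
Proof. exact/lpa_eval_eq/lpa_repr_class. Qed.

Fact lpa_lift_linear : linear lpa_lift.
Proof.
move=> a; do 2![elim/lpa_ind => ?].
by rewrite -lpa_classZ -lpa_classD !lpa_liftE.
Qed.

HB.instance Definition _ :=
  GRing.isLinear.Build R (leavitt_path_algebra R E) A _ lpa_lift
    lpa_lift_linear.

Lemma lpa_universal : exists phi : {linear leavitt_path_algebra R E -> A},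
  [/\ {morph phi : x y / x ** y},
      forall v, phi (lpa_p R v) = p v, forall e, phi (lpa_s R e) = s e,
      forall e, phi (lpa_t R e) = t e &
      forall psi : {linear leavitt_path_algebra R E -> A},
        {morph psi : x y / x ** y} -> (forall v, psi (lpa_p R v) = p v) ->
        (forall e, psi (lpa_s R e) = s e) ->
        (forall e, psi (lpa_t R e) = t e) -> psi =1 phi].
Proof.
exists lpa_lift; split=> [||||psi pM pp ps pt].
- by do 2![elim/lpa_ind => ?]; rewrite -lpa_classM /= !lpa_liftE.
- by move=> v; exact: lpa_liftE.
- by move=> e; exact: lpa_liftE.
- by move=> e; exact: lpa_liftE.
elim/lpa_ind => x /=; rewrite lpa_liftE.
elim: x => //= [|x IHx y IHy|x IHx|a x IHx|x IHx y IHy].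
- exact: linear0.
- by rewrite lpa_classD linearD IHx IHy.
- by rewrite lpa_classN linearN IHx.
- by rewrite lpa_classZ linearZ IHx.
- by rewrite lpa_classM pM IHx IHy.
Qed.

End universal_property.

(* Main.v *)
From HB Require Import structures.
From mathcomp Require Import all_boot all_order all_algebra finmap.
From mathcomp Require Import all_classical topology.
From mathcomp Require Import ring zify.
Require Import Defs.
Set Implicit Arguments.
Unset Strict Implicit.
Unset Printing Implicit Defensive.
Import Order.TTheory GRing.Theory Num.Theory.
Local Open Scope classical_set_scope.
Local Open Scope ring_scope.

(** The isomorphism sends [p v], [s e] and the ghost edge [t e] to the
characteristic functions of the compact open bisections [Z(v, v)],
[Z(e, src e)] and [Z(src e, e)].

Convolution is associative on all functions with finite support on each range
fibre of the groupoid ([convolutionA]), so these functions form an algebra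
[row_finite], which contains the characteristic functions of bisections.  Those
multiply as the bisections do ([convolution_indic]), whence the defining
relations of the Leavitt path algebra ([graph_family]), and the universal
property gives a multiplicative linear map [graph_lift] into [row_finite].

Its image is the span of the characteristic functions of the cylinders
[Z(mu, nu)] ([lift_cylinder_span], [cylinder_span_lift]).  Cylinders are open,
closed and compact ([cylinder_compact]), so the image lies in the Steinberg
algebra.  Conversely, two cylinders are disjoint or nested, so the sets whose
characteristic function lies in the span form a ring of sets; it contains the
basic open sets, and a locally constant function of compact support is
constant on each of finitely many basic open sets covering its support, hence
is in the span ([steinberg_cylinder_span]).

Injectivity is proved by induction on a degree: [lpa_depth n] contains the
linear combinations of products of a path of length at most [n] and a ghost
path, and every element belongs to some [lpa_depth n]
([lpa_depth_exists]).  Let [x] of degree at most [n.+1] be in the kernel.  Then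
each [t e ** x] is in the kernel and of degree at most [n], hence vanishes; it
is enough to see that [p v ** x = 0] for each vertex [v] ([lpa_eq0]).  If [v]
receives finitely many edges, and at least one, then [p v] is the sum of the
[s e ** t e].  Otherwise [v] itself is a boundary path, which does not start
with any edge; evaluating the image of [x] at arrows of range [v] isolates
the ghost paths ending at [v] in [x] and shows that their coefficients
are zero ([lift_ghost_sum_eq0]), and what remains of [p v ** x] is a finite sum
of elements [s e ** y], which is zero too ([edge_sum_eq0]).  In degree [0] there
are only ghost paths, and the same evaluation applies at any boundary path of
range [v]. *)

(** * Functions finitely supported on the range fibres of a groupoid *)

Section groupoid_theory.
Variable G : topGroupoidType.
Implicit Types a b c : G.

Lemma gmulKV a c : grng a = grng c -> gmul a (gmul (ginv a) c) = c.
Proof.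
by move=> ac; rewrite gmulA ?gsrc_inv ?grng_inv// gmulgV ac gmul_idl.
Qed.

Lemma gmulVK a c : gsrc a = grng c -> gmul (ginv a) (gmul a c) = c.
Proof.
by move=> ac; rewrite gmulA ?gsrc_inv// gmulVg ac gmul_idl.
Qed.

Lemma gmulV_eq a b c : gsrc a = grng b -> gmul a b = c -> b = gmul (ginv a) c.
Proof. by move=> ab <-; rewrite gmulVK. Qed.

Lemma grng_mulV a c : grng a = grng c -> grng (gmul (ginv a) c) = gsrc a.
Proof. by move=> ac; rewrite grng_mul ?grng_inv// gsrc_inv. Qed.

Lemma gmulV_cancel a b c : grng b = grng a -> grng b = grng c ->
  gmul (ginv (gmul (ginv b) a)) (gmul (ginv b) c) = gmul (ginv a) c.
Proof.
move=> ba bc; apply/esym/gmulV_eq.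
  by rewrite gsrc_mul ?gsrc_inv// grng_mulV// -ba bc.
rewrite -gmulA ?gsrc_inv ?gmulKV// -?ba ?bc//.
by rewrite grng_mulV// -ba bc.
Qed.

End groupoid_theory.

Section row_finite.
Variables (R : comPzRingType) (G : topGroupoidType).
Implicit Types (f g h : G -> R^o) (a b c : G).

(** The support of [f] on the fibre of arrows of range [u]. *)
Definition row_support f (u : @gunit G) : set G :=
  [set a | grng a = u /\ f a != 0].

(** The functions with finite support on each range fibre. *)
Definition row_finite_set : set (G -> R^o) :=
  [set f | forall u, finite_set (row_support f u)].

Definition row_finite_pred : {pred G -> R^o} := [pred f | f \in row_finite_set].

Lemma row_finite_submod_closed : submod_closed row_finite_pred.
Proof.
split.
  rewrite !inE => u; rewrite /row_support (_ : [set _ | _] = set0)//.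
  by apply/seteqP; split=> x //= -[_]; rewrite eqxx.
move=> k f g; rewrite !inE => rf rg u.
apply: (@sub_finite_set _ _ (row_support f u `|` row_support g u)); last first.
  by rewrite finite_setU; split.
move=> a [/= au]; rewrite (_ : (k *: f + g) a = k *: f a + g a)// => fg.
have [f0|f0] := eqVneq (f a) 0; last by left.
by right; split=> //; move: fg; rewrite f0 scaler0 add0r.
Qed.

(** A pair of product [c] is determined by its first component, so that the
convolution at [c] is a sum over arrows of the same range as [c]. *)
Lemma convolutionE f g c (S : set G) : finite_set S ->
  S `<=` [set a | grng a = grng c] -> row_support f (grng c) `<=` S ->
  convolution f g c = \sum_(a \in S) (f a * g (gmul (ginv a) c) : R).
Proof.
move=> fS Sc fSS; rewrite /convolution.
pose k (a : G) := (a, gmul (ginv a) c).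
rewrite -(@fsbig_widen _ _ _ _ (k @` S)).
- rewrite fsbig_image// => a b _ _; exact: (congr1 fst).
- move=> _ [a /Sc /= ac <-]; split=> /=; first by rewrite grng_mulV.
  exact: gmulKV.
- move=> [a b] /= [[ab abc] nS].
  have ac : grng a = grng c by rewrite -abc grng_mul.
  have [->|fa] := eqVneq (f a) 0; first by rewrite mul0r.
  exfalso; apply: nS; exists a; first exact: fSS.
  by rewrite /k (gmulV_eq ab abc).
Qed.

Lemma row_support_convolution f g c :
  finite_set (row_support f (grng c)) -> convolution f g c != 0 ->
  exists a b, [/\ row_support f (grng c) a, row_support g (gsrc a) b &
    c = gmul a b].
Proof.
move=> rf; rewrite (convolutionE _ rf) ?fsbig_finite//; last by move=> a [].
move=> /eqP n0; apply: contrapT => nab; apply: n0.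
rewrite big1_seq// => a /=; rewrite in_fset_set// inE => fa.
have [ac _] := fa.
have [->|gb] := eqVneq (g (gmul (ginv a) c)) 0; first by rewrite mulr0.
exfalso; apply: nab; exists a, (gmul (ginv a) c); split=> //.
  by split=> //; rewrite grng_mulV.
by rewrite gmulKV.
Qed.

(** The products of range [u] of an arrow of the support of [f] by one of the
support of [g]. *)
Definition row_product f g u : set G :=
  \bigcup_(b in row_support f u) (gmul b @` row_support g (gsrc b)).

Lemma finite_row_product f g u : row_finite_set f -> row_finite_set g ->
  finite_set (row_product f g u).
Proof. by move=> rf rg; apply: bigcup_finite => // b _; exact: finite_image. Qed.

Lemma row_product_rng f g u : row_product f g u `<=` [set a | grng a = u].
Proof. by move=> _ [b [<- _] [d [db _] <-]] /=; rewrite grng_mul. Qed.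

Lemma row_support_product f g u : row_finite_set f ->
  row_support (convolution f g) u `<=` row_product f g u.
Proof.
move=> rf c [<- fg0].
have [a [b [fa gb cE]]] := row_support_convolution (rf _) fg0.
by exists a => //; exists b.
Qed.

Lemma row_finite_convolution f g : row_finite_set f -> row_finite_set g ->
  row_finite_set (convolution f g).
Proof.
move=> rf rg u; apply: (@sub_finite_set _ _ (row_product f g u)).
  exact: row_support_product.
exact: finite_row_product.
Qed.

Lemma convolutionA f g h : row_finite_set f -> row_finite_set g ->
  convolution f (convolution g h) = convolution (convolution f g) h.
Proof.
move=> rf rg; apply/funext => c.
set S := row_support f (grng c); set P := row_product f g (grng c).
have fS : finite_set S by exact: rf.
have fP : finite_set P by exact: finite_row_product.
have Pc : P `<=` [set a | grng a = grng c] by exact: row_product_rng.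
have Sc : S `<=` [set a | grng a = grng c] by move=> a [].
rewrite [RHS](convolutionE _ fP)//; last exact: row_support_product.
rewrite (convolutionE _ fS)// !fsbig_finite//.
transitivity (\sum_(b <- fset_set S) \sum_(a <- fset_set P)
   (f b * (g (gmul (ginv b) a) * h (gmul (ginv a) c)) : R)).
  apply: eq_big_seq => b; rewrite in_fset_set// inE => Sb.
  have bc := Sc _ Sb.
  rewrite -mulr_sumr; congr (_ * _).
  rewrite (@convolutionE _ _ _ (gmul (ginv b) @` P)).
  - rewrite fsbig_image.
      rewrite fsbig_finite//; apply: eq_big_seq => a.
      by rewrite in_fset_set// inE => /Pc ac; rewrite gmulV_cancel// ac.
    move=> a a' /set_mem/Pc ac /set_mem/Pc ac' /(congr1 (gmul b)).
    by rewrite !gmulKV// ?ac ?ac'.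
  - exact: finite_image.
  - move=> _ [a /Pc ac <-] /=.
    by rewrite !grng_mulV// ac.
  - move=> d [/=]; rewrite grng_mulV// => db gd.
    exists (gmul b d); last by rewrite gmulVK.
    by exists b => //; exists d.
rewrite exchange_big/=; apply: eq_big_seq => a; rewrite in_fset_set// inE => Pa.
rewrite (convolutionE _ fS) ?(Pc _ Pa)//.
by rewrite fsbig_finite// mulr_suml; apply: eq_bigr => b _; rewrite mulrA.
Qed.

Lemma convolutionDl f g h : row_finite_set f -> row_finite_set g ->
  convolution (f + g) h = convolution f h + convolution g h.
Proof.
move=> rf rg; apply/funext => c.
pose S := row_support f (grng c) `|` row_support g (grng c).
have fS : finite_set S by rewrite finite_setU; split.
have Sc : S `<=` [set a | grng a = grng c] by move=> a [[]|[]].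
rewrite (convolutionE _ fS)//; last first.
  move=> a [ac]; rewrite (_ : (f + g) a = f a + g a)// => fga.
  have [f0|f0] := eqVneq (f a) 0; last by left.
  by right; split=> //; move: fga; rewrite f0 add0r.
transitivity (convolution f h c + convolution g h c) => //.
rewrite (@convolutionE f _ _ S)//; last by move=> a ?; left.
rewrite (@convolutionE g _ _ S)//; last by move=> a ?; right.
by rewrite -fsbig_split//; apply: eq_fsbigr => a _; exact: mulrDl.
Qed.

Lemma convolutionDr f g h : row_finite_set f ->
  convolution f (g + h) = convolution f g + convolution f h.
Proof.
move=> rf; apply/funext => c.
transitivity (convolution f g c + convolution f h c) => //.
rewrite !(convolutionE _ (rf (grng c)))//; try by move=> a [].
by rewrite -fsbig_split//; apply: eq_fsbigr => a _; exact: mulrDr.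
Qed.

Lemma convolutionZl (k : R) f g : row_finite_set f ->
  convolution (k *: f) g = k *: convolution f g.
Proof.
move=> rf; apply/funext => c.
transitivity (k * convolution f g c : R) => //.
rewrite !(@convolutionE _ _ _ (row_support f (grng c)))//.
- by rewrite !fsbig_finite// mulr_sumr; apply: eq_bigr => a _; rewrite mulrA.
- by move=> a [].
- by move=> a [].
move=> a [ac]; rewrite (_ : (k *: f) a = k * f a)// => kf; split=> //.
by apply: contraNneq kf => ->; rewrite mulr0.
Qed.

Lemma convolutionZr (k : R) f g : row_finite_set f ->
  convolution f (k *: g) = k *: convolution f g.
Proof.
move=> rf; apply/funext => c.
transitivity (k * convolution f g c : R) => //.
rewrite !(convolutionE _ (rf (grng c)))//; try by move=> a [].
rewrite !fsbig_finite// mulr_sumr; apply: eq_bigr => a _.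
by rewrite (_ : (k *: g) _ = k * g (gmul (ginv a) c))// mulrCA.
Qed.

(** The algebra of functions with finite support on each range fibre, under
convolution; no topology is involved. *)
Record row_finite := RowFinite {
  row_finite_val :> G -> R^o;
  row_finite_valP : row_finite_pred row_finite_val
}.

HB.instance Definition _ := [isSub for row_finite_val].
HB.instance Definition _ := [Choice of row_finite by <:].
HB.instance Definition _ :=
  GRing.SubChoice_isSubLmodule.Build R (G -> R^o) row_finite_pred
    row_finite (GRing.submod_closed_semi row_finite_submod_closed).

Implicit Types x y z : row_finite.

Lemma row_finiteP x : row_finite_set x.
Proof. exact: set_mem (row_finite_valP x). Qed.

Lemma row_finite_mul_proof x y : row_finite_pred (convolution x y).
Proof. by apply: mem_set; apply: row_finite_convolution; exact: row_finiteP. Qed.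

Definition row_finite_mul x y := RowFinite (row_finite_mul_proof x y).

Fact row_finite_mulA : associative row_finite_mul.
Proof.
move=> x y z; apply: val_inj.
by apply: convolutionA; exact: row_finiteP.
Qed.

Fact row_finite_mulDl : left_distributive row_finite_mul +%R.
Proof. by move=> x y z; apply: val_inj; apply: convolutionDl; exact: row_finiteP. Qed.

Fact row_finite_mulDr : right_distributive row_finite_mul +%R.
Proof. by move=> x y z; apply: val_inj; apply: convolutionDr; exact: row_finiteP. Qed.

Fact row_finite_mulZl (k : R) x y :
  row_finite_mul (k *: x) y = k *: row_finite_mul x y.
Proof. by apply: val_inj; apply: convolutionZl; exact: row_finiteP. Qed.

Fact row_finite_mulZr (k : R) x y :
  row_finite_mul x (k *: y) = k *: row_finite_mul x y.
Proof. by apply: val_inj; apply: convolutionZr; exact: row_finiteP. Qed.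

HB.instance Definition _ := Lmodule_isNuAlgebra.Build R row_finite
  row_finite_mulA row_finite_mulDl row_finite_mulDr row_finite_mulZl
  row_finite_mulZr.

Lemma row_finite_valM x y : row_finite_val (x ** y) = convolution x y.
Proof. by []. Qed.

Lemma row_finite_val_inj : injective row_finite_val.
Proof. exact: val_inj. Qed.

Lemma row_finite_val_sum I (r : seq I) (P : pred I) (F : I -> row_finite) :
  row_finite_val (\sum_(i <- r | P i) F i) =
  \sum_(i <- r | P i) row_finite_val (F i).
Proof. exact: (big_morph row_finite_val). Qed.

(** The characteristic function of [B]. *)
Definition indic_fun (B : set G) : G -> R^o := fun a => (a \in B)%:R.

(** The range map is injective on [B], as on any bisection. *)
Definition rng_injective (B : set G) :=
  forall a b, B a -> B b -> grng a = grng b -> a = b.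

(** The set of the composites of an arrow of [B] by an arrow of [C]. *)
Definition set_gmul (B C : set G) : set G :=
  [set c | exists a b, [/\ B a, C b, gsrc a = grng b & c = gmul a b]].

Lemma indic_row_finite (B : set G) : rng_injective B ->
  row_finite_set (indic_fun B).
Proof.
move=> iB u.
have supB a : row_support (indic_fun B) u a -> B a /\ grng a = u.
  move=> [au]; rewrite /indic_fun; case: (boolP (a \in B)) => [|_].
    by rewrite inE.
  by rewrite eqxx.
have [[a /supB[Ba au]]|/set0P/negP/negPn/eqP ->//] :=
  pselect (row_support (indic_fun B) u !=set0).
apply: (@sub_finite_set _ _ [set a]) => // b /supB[Bb bu] /=.
by apply: iB => //; rewrite au.
Qed.

Lemma convolution_indic (B C : set G) : rng_injective B ->
  convolution (indic_fun B) (indic_fun C) = indic_fun (set_gmul B C).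
Proof.
move=> iB; apply/funext => c; rewrite {3}/indic_fun.
have [|nBC] := boolP (c \in set_gmul B C).
  rewrite inE => -[a [b [Ba Cb ab cE]]].
  have ac : grng a = grng c by rewrite cE grng_mul.
  rewrite (@convolutionE _ _ _ [set a])//.
  - rewrite fsbig_set1 /indic_fun.
    have -> : gmul (ginv a) c = b by rewrite cE gmulVK.
    by rewrite !mem_set// mulr1.
  - by move=> ? ->.
  - move=> d [dc]; rewrite /indic_fun; case: (boolP (d \in B)).
      by rewrite inE => Bd _; apply: iB => //; rewrite ac.
    by rewrite eqxx.
apply: contraNeq nBC => BC; rewrite inE.
have [a [b [[ac fa] [ba gb] cE]]] :=
  row_support_convolution (indic_row_finite iB _) BC.
have ind0 (D : set G) d : indic_fun D d != 0 -> D d.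
  by rewrite /indic_fun; case: (boolP (d \in D)); rewrite ?inE// eqxx.
by exists a, b; split=> //; exact: ind0.
Qed.

End row_finite.

(** * Boundary paths and cylinder sets of the graph groupoid *)

Section boundary_paths.
Variable E : digraph.
Implicit Types (v w : vertex E) (e : edge E) (s : seq (edge E)).
Implicit Types (mu nu al be la : fpath E) (x y : gpath E).

(** The path of length [0] at a vertex. *)
Definition vpath v : fpath E := (v, [::]).
(** The path of length [1] along an edge. *)
Definition epath e : fpath E := (rng e, [:: e]).

Lemma path_from_rcons v s e :
  path_from v (rcons s e) <-> path_from v s /\ rng e = last v (map src s).
Proof. by rewrite -cats1 path_from_cat /=; tauto. Qed.

Lemma finite_vpath v : finite_path E (vpath v). Proof. by []. Qed.

Lemma finite_epath e : finite_path E (epath e). Proof. by []. Qed.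

Lemma fpath_cat_vpath mu v : fpath_cat mu (vpath v) = mu.
Proof. by case: mu => w s; rewrite /fpath_cat/= cats0. Qed.

Lemma vpath_cat mu : fpath_cat (vpath (fpath_rng mu)) mu = mu.
Proof. by case: mu. Qed.

(** The path of length [0] at [v] is a boundary path exactly when [v] is a source
or an infinite receiver. *)
Lemma singular_vpath v :
  boundary_path E (Fin (vpath v)) <-> is_source v \/ infinite_receiver v.
Proof. by split=> [[]|]. Qed.

(** A boundary path has length [0] or starts with an edge. *)
Lemma boundary_pathP x : boundary_path E x ->
  x = Fin (vpath (gpath_rng x)) \/
  exists e y, [/\ boundary_path E y, src e = gpath_rng y &
                  x = gpath_cat (epath e) y].
Proof.
case: x => [[v [|e s]]|x] /=; first by left.
  move=> [[/= ev ps] sing]; subst v; right; exists e, (Fin (src e, s)).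
  by split.
move=> px; right; exists (x 0%N), (Inf (fun n => x n.+1)); split=> //=.
by congr Inf; apply/funext => -[].
Qed.

(** From the path of length [0], extend edge by edge as long as [P] allows it:
either this stops at some path, or it yields an infinite path. *)
Lemma blocked_or_infinite_branch v (P : seq (edge E) -> Prop) : P [::] ->
  (exists s, [/\ path_from v s, P s &
     forall e, path_from v (rcons s e) -> ~ P (rcons s e)]) \/
  (exists y : nat -> edge E, [/\ infinite_path y, rng (y 0%N) = v &
     forall n, path_from v (mkseq y n) /\ P (mkseq y n)]).
Proof.
move=> P0; have [|nblocked] := pselect (exists s, [/\ path_from v s, P s &
     forall e, path_from v (rcons s e) -> ~ P (rcons s e)]); first by left.
right.
pose good s := path_from v s /\ P s.
have ext s : good s -> exists e, good (rcons s e).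
  move=> [ps Ps]; apply: contrapT => ne; apply: nblocked.
  by exists s; split=> // e pe Pe; apply: ne; exists e.
have [e0 _] := ext [::] (conj I P0).
have /choice[next nextP] s : exists e, good s -> good (rcons s e).
  by have [/ext[e]|ns] := pselect (good s); [exists e|exists e0].
pose br := fix br n := if n is n'.+1 then rcons (br n') (next (br n')) else [::].
pose y n := next (br n).
have brE n : br n = mkseq y n.
  by elim: n => // n IH; rewrite mkseqS -IH.
have gy n : good (mkseq y n).
  by elim: n => // n; rewrite mkseqS -brE => /nextP.
exists y; split=> //.
- move=> i; have [+ _] := gy i.+2.
  by rewrite !mkseqS => /path_from_rcons[_]; rewrite map_rcons last_rcons => ->.
- by have [[]] := gy 1%N.
Qed.

(** Every vertex is the range of a boundary path: walk until a source is met, or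
forever. *)
Lemma boundary_path_exists v : exists2 x, boundary_path E x & gpath_rng x = v.
Proof.
have [[s [ps _ sn]]|[y [py yv _]]] :=
    @blocked_or_infinite_branch v (fun=> True) I; last by exists (Inf y).
exists (Fin (v, s)) => //; split=> //; left.
apply/seteqP; split=> // e re; exfalso; apply: (sn e) => //.
exact/path_from_rcons.
Qed.

Lemma infinite_path_split (y : nat -> edge E) n : Inf y =
  gpath_cat (rng (y 0%N), mkseq y n) (Inf (fun i => y (n + i)%N)).
Proof.
congr Inf => /=; elim: n y => [|n IH] y.
  by apply/funext => i.
rewrite /mkseq /= (iotaDl 1 0) -map_comp.
apply/funext => -[|i] //=.
by have /(congr1 (@^~ i)) := IH (fun i => y i.+1).
Qed.

Lemma infinite_path_drop (y : nat -> edge E) n : infinite_path y ->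
  infinite_path (fun i => y (n + i)%N).
Proof. by move=> py i; rewrite addnS. Qed.

End boundary_paths.

Section cylinders.
Variable E : digraph.
Implicit Types (v w : vertex E) (e f : edge E).
Implicit Types (mu nu al be la : fpath E) (x y : gpath E).
Implicit Types (g h : graph_groupoid E).

(** The pairs of paths for which [cylinder mu nu] is the basic set Z(mu, nu). *)
Definition coterminal mu nu :=
  [/\ finite_path E mu, finite_path E nu & fpath_src mu = fpath_src nu].

Lemma cylinder_elt mu nu x : coterminal mu nu -> boundary_path E x ->
  fpath_src mu = gpath_rng x ->
  exists2 g, cylinder mu nu g & gg_val g =
    (gpath_cat mu x, (fpath_len mu)%:Z - (fpath_len nu)%:Z, gpath_cat nu x).
Proof.
move=> [pm pn mn] bx mx.
have gE : graph_groupoid_elt E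
    (gpath_cat mu x, (fpath_len mu)%:Z - (fpath_len nu)%:Z, gpath_cat nu x).
  by exists mu, nu, x; split=> //; rewrite -mn.
by exists (GraphGroupoid gE) => //; exists x.
Qed.

Lemma gsrc_rngP g h : gsrc g = grng h <-> g.2 = h.1.1.
Proof. exact: gg_src_rngP. Qed.

Lemma gmul_val g h : gsrc g = grng h ->
  gg_val (gmul g h) = (g.1.1, g.1.2 + h.1.2, h.2).
Proof. exact: gg_mulE. Qed.

Lemma grng_val g h : grng g = grng h -> g.1.1 = h.1.1.
Proof. by move=> /(congr1 val). Qed.

Lemma coterminal_cat mu nu la : coterminal mu nu -> finite_path E la ->
  fpath_rng la = fpath_src mu ->
  coterminal (fpath_cat mu la) (fpath_cat nu la).
Proof.
move=> [pm pn mn] pl lm; split; rewrite ?fpath_src_cat -?mn//.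
  exact: finite_path_cat.
by apply: finite_path_cat; rewrite -?mn.
Qed.

Lemma cylinder_rng_injective mu nu : finite_path E mu ->
  rng_injective (cylinder mu nu).
Proof.
move=> pm g h [x [bx mx gE]] [y [By my hE]] /grng_val.
rewrite gE hE /= => /gpath_cat_inj xy; apply: gg_val_inj.
by rewrite gE hE xy// -mx -my.
Qed.

(** Z(mu, nu) Z(nu al, la) = Z(mu al, la); [cylinder_mull] is the mirror
identity. *)
Lemma cylinder_mulr mu nu al la : coterminal mu nu -> finite_path E al ->
  fpath_rng al = fpath_src mu -> coterminal (fpath_cat nu al) la ->
  set_gmul (cylinder mu nu) (cylinder (fpath_cat nu al) la) =
  cylinder (fpath_cat mu al) la.
Proof.
move=> cmn pa am cal; have [pm pn mn] := cmn; have [pna pl nal] := cal.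
have an : fpath_rng al = fpath_src nu by rewrite -mn.
apply/seteqP; split=> [_ [g [h [[x [bx mx gE]] [y [By ny hE]] gh ->]]]|k].
  move: ny; rewrite fpath_src_cat// => ay.
  exists y; rewrite fpath_src_cat//; split=> //.
  rewrite gmul_val//; move/gsrc_rngP : gh; rewrite gE hE /=.
  rewrite -gpath_catA => /gpath_cat_inj -> //; last first.
    by rewrite gpath_rng_cat// -mx.
  rewrite gpath_catA !fpath_len_cat !PoszD; congr (_, _, _); ring.
move=> [y [By]]; rewrite fpath_src_cat// => ay kE.
have [g gmn gE] := @cylinder_elt mu nu (gpath_cat al y) cmn
  (boundary_path_cat pa By ay) (esym (etrans (gpath_rng_cat pa ay) am)).
have nay : fpath_src (fpath_cat nu al) = gpath_rng y by rewrite fpath_src_cat.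
have [h hal hE] := cylinder_elt cal By nay.
have gh : gsrc g = grng h by apply/gsrc_rngP; rewrite gE hE /= gpath_catA.
exists g, h; split=> //; apply: gg_val_inj.
rewrite gmul_val// gE hE kE /= gpath_catA !fpath_len_cat !PoszD.
congr (_, _, _); ring.
Qed.

Lemma cylinder_mull mu nu al la : coterminal nu la -> finite_path E al ->
  fpath_rng al = fpath_src nu -> coterminal mu (fpath_cat nu al) ->
  set_gmul (cylinder mu (fpath_cat nu al)) (cylinder nu la) =
  cylinder mu (fpath_cat la al).
Proof.
move=> cnl pa an cma; have [pn pl nl] := cnl; have [pm pna ma] := cma.
have al' : fpath_rng al = fpath_src la by rewrite -nl.
have {}ma : fpath_src mu = fpath_src al by rewrite ma fpath_src_cat.
apply/seteqP; split=> [_ [g [h [[x [bx mx gE]] [y [By ny hE]] gh ->]]]|k].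
  exists x; split=> //.
  have ax : fpath_src al = gpath_rng x by rewrite -ma.
  rewrite gmul_val//; move/gsrc_rngP : gh; rewrite gE hE /=.
  rewrite -gpath_catA => /gpath_cat_inj <- //; last first.
    by rewrite gpath_rng_cat// an.
  rewrite gpath_catA !fpath_len_cat !PoszD; congr (_, _, _); ring.
move=> [x [bx mx kE]].
have ax : fpath_src al = gpath_rng x by rewrite -ma.
have [h hnl hE] := @cylinder_elt nu la (gpath_cat al x) cnl
  (boundary_path_cat pa bx ax) (esym (etrans (gpath_rng_cat pa ax) an)).
have [g gma gE] := cylinder_elt cma bx mx.
have gh : gsrc g = grng h by apply/gsrc_rngP; rewrite gE hE /= gpath_catA.
exists g, h; split=> //; apply: gg_val_inj.
rewrite gmul_val// gE hE kE /= gpath_catA !fpath_len_cat !PoszD.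
congr (_, _, _); ring.
Qed.

Lemma cylinder_mul mu nu la : coterminal mu nu -> coterminal nu la ->
  set_gmul (cylinder mu nu) (cylinder nu la) = cylinder mu la.
Proof.
move=> cmn cnl; have [_ _ mn] := cmn.
have := @cylinder_mulr mu nu (vpath (fpath_src mu)) la.
by rewrite !fpath_cat_vpath; apply.
Qed.

(** Two cylinders whose middle paths have no common extension do not compose. *)
Lemma cylinder_mul0 mu nu nu' la :
  (forall x y, boundary_path E x -> fpath_src nu = gpath_rng x ->
     boundary_path E y -> fpath_src nu' = gpath_rng y ->
     gpath_cat nu x <> gpath_cat nu' y) -> coterminal mu nu ->
  set_gmul (cylinder mu nu) (cylinder nu' la) = set0.
Proof.
move=> nn' [pm pn mn]; apply/seteqP; split=> // k.
move=> [g [h [[x [bx mx gE]] [y [By ny hE]] /gsrc_rngP gh _]]].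
by move: gh; rewrite gE hE /=; apply: nn' => //; rewrite -mn.
Qed.

Lemma cylinder_mul0_rng mu nu nu' la : fpath_rng nu != fpath_rng nu' ->
  finite_path E nu' -> coterminal mu nu ->
  set_gmul (cylinder mu nu) (cylinder nu' la) = set0.
Proof.
move=> nn' pn' cmn; apply: cylinder_mul0 => // x y bx nx By ny.
have [pm pn mn] := cmn.
move=> /(congr1 (@gpath_rng E)); rewrite !gpath_rng_cat// => e.
by rewrite e eqxx in nn'.
Qed.

(** Two cylinders are disjoint or nested. *)
Lemma cylinderI_cases mu nu mu' nu' : coterminal mu nu -> coterminal mu' nu' ->
  (fpath_len mu <= fpath_len mu')%N ->
  cylinder mu nu `&` cylinder mu' nu' = set0 \/
  cylinder mu' nu' `<=` cylinder mu nu.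
Proof.
move=> [pm pn mn] [pm' pn' mn'] le.
have [[g [gm gm']]|/set0P/negP/negPn/eqP] :=
  pselect (cylinder mu nu `&` cylinder mu' nu' !=set0); last by left.
right; have [la [pl lm -> ->]] := cylinder_nested pm pn mn pm' pn' mn' gm gm' le.
by apply: cylinder_cat => //; rewrite lm.
Qed.

End cylinders.

Section topology.
Variable E : digraph.
Implicit Types (v w : vertex E) (e f : edge E).
Implicit Types (mu nu al be la : fpath E) (x y : gpath E).
Implicit Types (g h : graph_groupoid E).

Lemma basic_open (B : set (graph_groupoid E)) : basic_sets B -> open B.
Proof.
move=> bB; exists [set B]; first by move=> _ ->.
by rewrite bigcup_set1.
Qed.

Lemma nbhs_basic g (U : set (graph_groupoid E)) : nbhs g U ->
  exists B, [/\ basic_sets B, B g & B `<=` U].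
Proof.
rewrite nbhsE => -[V [[D' D'b <-] [B D'B Bg]] VU].
exists B; split=> //; first exact: D'b.
by move=> h Bh; apply: VU; exists B.
Qed.

Lemma cylinder_basic mu nu : coterminal mu nu -> basic_sets (cylinder mu nu).
Proof.
move=> [pm pn mn]; exists mu, nu, set0; split=> //.
by rewrite /cylinderD bigcup_set0 setD0.
Qed.

Lemma cylinder_open mu nu : coterminal mu nu -> open (cylinder mu nu).
Proof. by move=> cmn; apply/basic_open/cylinder_basic. Qed.

Lemma cylinder_closed mu nu : coterminal mu nu -> closed (cylinder mu nu).
Proof.
move=> cmn; rewrite -[cylinder mu nu]setCK; apply: open_closedC.
rewrite openE => g ng.
have [al [be [x [pa pb bx [ax bex] gE]]]] := gg_valP g.
have cab : coterminal al be by split=> //; rewrite ax bex.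
have gab : cylinder al be g by exists x.
suff [B [bB Bg sB]] : exists B, [/\ basic_sets B, B g & B `<=` ~` cylinder mu nu].
  by apply: filterS sB _; apply: open_nbhs_nbhs; split=> //; exact: basic_open.
have [le|lt] := leqP (fpath_len mu) (fpath_len al).
  have [I0|sI] := cylinderI_cases cmn cab le; last by case: (ng); exact: sI.
  exists (cylinder al be); split=> //; first exact: cylinder_basic.
  by move=> h hab hmn; have : set0 h by rewrite -I0.
have [I0|[h [hab hmn]]] : cylinder al be `&` cylinder mu nu = set0 \/
    cylinder al be `&` cylinder mu nu !=set0.
  by have [|/set0P] := eqVneq (cylinder al be `&` cylinder mu nu) set0;
    [left|right].
  exists (cylinder al be); split=> //; first exact: cylinder_basic.
  by move=> h hab hmn; have : set0 h by rewrite -I0.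
have [pm pn mn] := cmn; have [_ _ ab] := cab.
have [la [pl la_al muE nuE]] :=
  cylinder_nested pa pb ab pm pn mn hab hmn (ltnW lt).
exists (cylinderD al be [set la]); split.
- by exists al, be, [set la]; split=> // _ ->.
- by split=> //; rewrite bigcup_set1 -muE -nuE.
- by move=> k []; rewrite bigcup_set1 -muE -nuE.
Qed.

(** Cylinders and their complements generate the topology, so an ultrafilter
converges to [g] as soon as it contains exactly the cylinders containing
[g]. *)
Lemma ultra_cvg_cylinder (F : set_system (graph_groupoid E)) g :
  UltraFilter F ->
  (forall mu nu, coterminal mu nu -> cylinder mu nu g -> F (cylinder mu nu)) ->
  (forall mu nu, coterminal mu nu -> F (cylinder mu nu) -> cylinder mu nu g) ->
  F --> g.
Proof.
move=> FU Fcyl cylF U /nbhs_basic[B [[mu [nu [S [[pm pn] mn fS Sm BE]]]] Bg BU]].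
apply: filterS BU _; move: Bg; rewrite {}BE => -[gmn gS].
have cmn : coterminal mu nu by [].
rewrite /cylinderD setDE setC_bigcup -(fset_setK fS).
apply: filterI; first exact: Fcyl.
apply: filter_bigI => al; rewrite in_fset_set// inE => Sal.
have [pa am] := Sm _ Sal.
have [Fal|//] := in_ultra_setVsetC (cylinder (fpath_cat mu al) (fpath_cat nu al)) FU.
exfalso; apply: gS; exists al => //; apply: cylF => //.
exact: coterminal_cat.
Qed.

(** Given an ultrafilter [F] on Z(mu, nu), the paths [la] such that
Z(mu la, nu la) is in [F] form a tree; the limit of [F] is given by a path at
which this tree is blocked or, failing that, by an infinite branch. *)
Lemma cylinder_compact mu nu : coterminal mu nu -> compact (cylinder mu nu).
Proof.
move=> cmn; have [pm pn mn] := cmn.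
rewrite compact_ultra => F FU Fmn.
suff [g [gmn Fg gF]] : exists g, [/\ cylinder mu nu g,
    (forall al be, coterminal al be -> cylinder al be g -> F (cylinder al be)) &
    (forall al be, coterminal al be -> F (cylinder al be) -> cylinder al be g)].
  by exists g; split=> //; exact: ultra_cvg_cylinder.
set v := fpath_src mu.
pose Mu s := fpath_cat mu (v, s); pose Nu s := fpath_cat nu (v, s).
have cMN s : path_from v s -> coterminal (Mu s) (Nu s).
  by move=> ps; apply: coterminal_cat.
have sMu s : fpath_src (Mu s) = last v (map src s) by rewrite fpath_src_cat.
have [|[s [ps Fs blk]]|[y [py yv Fy]]] :=
    @blocked_or_infinite_branch E v (fun s => F (cylinder (Mu s) (Nu s))).
- by rewrite /Mu /Nu -![(v, [::])]/(vpath v) !fpath_cat_vpath.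
- pose w := last v (map src s).
  have cs := cMN s ps.
  (* If w receives finitely many edges, F contains the set of the elements of
     Z(mu s, nu s) that continue along none of them, which is thus nonempty; such
     an element can only be given by the path of length 0 at w. *)
  have wsing : boundary_path E (Fin (vpath w)).
    have [inf|fin] := pselect (infinite_receiver w).
      by apply/singular_vpath; right.
    have {}fin : finite_set (received w) by apply: contrapT.
    have : F (cylinder (Mu s) (Nu s) `&` \bigcap_(e in received w)
        ~` cylinder (Mu (rcons s e)) (Nu (rcons s e))).
      apply: filterI => //; rewrite -(fset_setK fin).
      apply: filter_bigI => e; rewrite in_fset_set// inE => ew.
      have pe : path_from v (rcons s e) by apply/path_from_rcons.
      by have [/(blk _ pe)|] := in_ultra_setVsetC
        (cylinder (Mu (rcons s e)) (Nu (rcons s e))) FU.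
    move=> /filter_ex[g [[x [bx]]]]; rewrite sMu => wx gE gn.
    have [xE|[e [z [bz ez xE]]]] := boundary_pathP bx.
      by rewrite /w wx -xE.
    exfalso.
    have ew : received w e by rewrite /received/= /w wx xE gpath_rng_cat.
    apply: (gn e ew); exists z.
    rewrite sMu map_rcons last_rcons; split=> //.
    rewrite gE xE !gpath_catA -!fpath_catA.
    have catE : fpath_cat (v, s) (epath e) = (v, rcons s e).
      by rewrite /fpath_cat/= cats1.
    rewrite catE !fpath_len_cat !PoszD /fpath_len/= size_rcons.
    congr (_, _, _); lia.
  have [g gs gE] := cylinder_elt cs wsing (sMu s).
  exists g; split.
  + by move: gs; apply: cylinder_cat => //; rewrite -?mn.
  + move=> al be cab gab.
    have le : (fpath_len al <= fpath_len (Mu s))%N.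
      have [z [_ _]] := gab; rewrite gE; case: z => [[u t]|//] [_ + _ _ _].
      move=> /(congr1 size); rewrite !size_cat addn0 /fpath_len/= size_cat => ->.
      exact: leq_addr.
    have [I0|sI] := cylinderI_cases cab cs le; last exact: filterS sI _.
    by have : set0 g by rewrite -I0.
  + move=> al be cab Fab.
    have /filter_ex[h [hab hs]] : F (cylinder al be `&` cylinder (Mu s) (Nu s)).
      exact: filterI.
    have [le|lt] := leqP (fpath_len al) (fpath_len (Mu s)).
      have [I0|sI] := cylinderI_cases cab cs le; last exact: sI.
      by have : set0 h by rewrite -I0.
    (* Otherwise al properly extends mu s, and the tree continues after s along
       the next edge of al. *)
    exfalso; have [pM pN MN] := cs; have [pa pb ab] := cab.
    have [la [pl la_Mu alE beE]] :=
      cylinder_nested pM pN MN pa pb ab hs hab (ltnW lt).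
    case: la pl la_Mu alE beE => [u [|e t]] /= pl la_Mu alE beE.
      by move: lt; rewrite alE fpath_len_cat /= addn0 ltnn.
    have pe : path_from v (rcons s e).
      apply/path_from_rcons; split=> //; rewrite -sMu -la_Mu.
      by case: pl.
    apply: (blk e pe); apply: filterS Fab.
    have MuE : al = fpath_cat (Mu (rcons s e)) (src e, t).
      by rewrite alE /fpath_cat/= -cats1 -!catA.
    have NuE : be = fpath_cat (Nu (rcons s e)) (src e, t).
      by rewrite beE /fpath_cat/= -cats1 -!catA.
    rewrite MuE NuE; apply: cylinder_cat => /=; first by case: pl.
      by rewrite sMu map_rcons last_rcons.
    by have [_ _ <-] := cMN _ pe; rewrite sMu map_rcons last_rcons.
- pose tl n := Inf (fun i => y (n + i)%N).
  have btl n : boundary_path E (tl n) by exact: infinite_path_drop.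
  have pY n : path_from v (mkseq y n) by case: (Fy n).
  have stl n : last v (map src (mkseq y n)) = gpath_rng (tl n).
    rewrite /= addn0; have := pY n.+1.
    by rewrite mkseqS => /path_from_rcons[_ ->].
  have bY : boundary_path E (Inf y) by [].
  have [g gmn gE] := cylinder_elt cmn bY (esym yv).
  have gn n : cylinder (Mu (mkseq y n)) (Nu (mkseq y n)) g.
    exists (tl n); split=> //; first by rewrite sMu.
    rewrite gE (infinite_path_split y n) yv !gpath_catA !fpath_len_cat !PoszD.
    congr (_, _, _); lia.
  have len n : (n <= fpath_len (Mu (mkseq y n)))%N.
    by rewrite fpath_len_cat /fpath_len/= size_mkseq leq_addl.
  exists g; split=> // al be cab.
  + move=> gab; have [_ Fn] := Fy (fpath_len al).
    have [I0|sI] := cylinderI_cases cab (cMN _ (pY _)) (len (fpath_len al)).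
      by have : set0 g by rewrite -I0.
    exact: filterS sI _.
  + move=> Fab; have [_ Fn] := Fy (fpath_len al).
    have [h] := filter_ex (filterI Fab Fn).
    have [I0|sI] := cylinderI_cases cab (cMN _ (pY _)) (len (fpath_len al)).
      by rewrite I0.
    by move=> _; exact: sI.
Qed.

End topology.

(** * The span of the characteristic functions of cylinders *)

(** Compactness in terms of covers by neighbourhoods indexed by points, for a
space that need not be pointed. *)
Lemma compact_finite_subcover (T : topologicalType) (K : set T)
    (U : T -> set T) : compact K -> (forall x, K x -> nbhs x (U x)) ->
  exists l : seq T, K `<=` \big[setU/set0]_(i <- l) U i.
Proof.
move=> /compact_near_coveringP cK KU.
(* F is the filter of properties that hold of all large enough lists. *)
pose F : set_system (seq T) :=
  [set V | exists l0 : seq T, forall l : seq T, {subset l0 <= l} -> V l].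
have FF : Filter F.
  split; first by exists [::].
    move=> V W [l Vl] [m Wm]; exists (l ++ m) => n lmn; split.
      by apply: Vl => x xl; apply: lmn; rewrite mem_cat xl.
    by apply: Wm => x xm; apply: lmn; rewrite mem_cat xm orbT.
  by move=> V W VW [l Vl]; exists l => n /Vl /VW.
have [|l Kl] := cK _ F (fun l x => (\big[setU/set0]_(i <- l) U i) x) FF.
  move=> x Kx; exists (U x, [set l : seq T | x \in l]) => /=.
    split; first exact: KU.
    by exists [:: x] => l xl; apply: xl; rewrite inE.
  move=> [y l] /= [Uy xl]; rewrite -bigcup_seq.
  by exists x.
by exists l; exact: Kl.
Qed.

Section cylinder_span.
Variables (R : comPzRingType) (E : digraph).
Local Notation G := (graph_groupoid E).
Local Notation ind := (indic_fun R).
Implicit Types (f h : G -> R^o) (mu nu : fpath E) (B C : set G) (k : R).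

(** The linear span of the characteristic functions of the cylinders. *)
Inductive cylinder_span : (G -> R^o) -> Prop :=
  | cylinder_span0 : cylinder_span 0
  | cylinder_spanC k mu nu f : coterminal mu nu -> cylinder_span f ->
      cylinder_span (k *: ind (cylinder mu nu) + f).

Lemma cylinder_spanD f h : cylinder_span f -> cylinder_span h ->
  cylinder_span (f + h).
Proof.
move=> + hs; elim=> [|k mu nu f' cmn _ IH]; first by rewrite add0r.
by rewrite -addrA; exact: cylinder_spanC.
Qed.

Lemma cylinder_spanZ k f : cylinder_span f -> cylinder_span (k *: f).
Proof.
elim=> [|l mu nu f' cmn _ IH]; first by rewrite scaler0; exact: cylinder_span0.
by rewrite scalerDr scalerA; exact: cylinder_spanC.
Qed.

Lemma cylinder_span_cylinder mu nu : coterminal mu nu ->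
  cylinder_span (ind (cylinder mu nu)).
Proof.
move=> cmn; rewrite -[X in cylinder_span X]addr0 -[ind _]scale1r.
by apply: cylinder_spanC => //; exact: cylinder_span0.
Qed.

Lemma indic_fun0 : ind (set0 : set G) = 0.
Proof. by apply/funext => g; rewrite /indic_fun in_set0. Qed.

Lemma indic_fun_mul B C g :
  (ind B g * ind C g : R) = ind (B `&` C) g.
Proof. by rewrite /indic_fun in_setI -natrM mulnb. Qed.

Lemma cylinder_span_cylinderI mu nu mu' nu' :
  coterminal mu nu -> coterminal mu' nu' ->
  cylinder_span (ind (cylinder mu nu `&` cylinder mu' nu')).
Proof.
wlog le : mu nu mu' nu' / (fpath_len mu <= fpath_len mu')%N.
  move=> H cmn cmn'; have [|/ltnW] := leqP (fpath_len mu) (fpath_len mu').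
    by move=> /H; exact.
  by rewrite setIC => /H; exact.
move=> cmn cmn'; have [->|sI] := cylinderI_cases cmn cmn' le.
  by rewrite indic_fun0; exact: cylinder_span0.
by rewrite setIidr//; exact: cylinder_span_cylinder.
Qed.

(** The pointwise product, as opposed to the convolution. *)
Definition pointwise_mul f h : G -> R^o := fun g => (f g * h g : R).

Lemma cylinder_spanM f h : cylinder_span f -> cylinder_span h ->
  cylinder_span (pointwise_mul f h).
Proof.
move=> + hs; elim=> [|k mu nu f' cmn _ IH].
  rewrite (_ : pointwise_mul _ _ = 0); first exact: cylinder_span0.
  by apply/funext => g; exact: mul0r.
rewrite (_ : pointwise_mul _ _ = k *: pointwise_mul (ind (cylinder mu nu)) h
    + pointwise_mul f' h); last first.
  apply/funext => g.
  transitivity ((k * ind (cylinder mu nu) g + f' g) * h g : R) => //.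
  by rewrite mulrDl -mulrA.
apply: cylinder_spanD IH; apply: cylinder_spanZ.
elim: hs => [|l mu' nu' h' cmn' _ IH].
  rewrite (_ : pointwise_mul _ _ = 0); first exact: cylinder_span0.
  by apply/funext => g; exact: mulr0.
rewrite (_ : pointwise_mul _ _ =
    l *: ind (cylinder mu nu `&` cylinder mu' nu')
    + pointwise_mul (ind (cylinder mu nu)) h'); last first.
  apply/funext => g.
  transitivity (ind (cylinder mu nu) g * (l * ind (cylinder mu' nu') g + h' g)
    : R) => //.
  by rewrite mulrDr mulrCA indic_fun_mul.
by apply: cylinder_spanD IH; apply: cylinder_spanZ; exact: cylinder_span_cylinderI.
Qed.

(** By this lemma and the next two, the sets whose characteristic function is in
the span form a ring of sets. *)
Lemma cylinder_span_indicI B C : cylinder_span (ind B) ->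
  cylinder_span (ind C) -> cylinder_span (ind (B `&` C)).
Proof.
move=> sB sC; have := cylinder_spanM sB sC; congr cylinder_span.
by apply/funext => g; exact: indic_fun_mul.
Qed.

Lemma cylinder_span_indicD B C : cylinder_span (ind B) ->
  cylinder_span (ind C) -> cylinder_span (ind (B `\` C)).
Proof.
move=> sB sC; have := cylinder_span_indicI sB sC.
move=> /(cylinder_spanZ (-1)) /(cylinder_spanD sB); congr cylinder_span.
apply/funext => g.
transitivity (ind B g + - 1 * ind (B `&` C) g : R) => //.
rewrite /indic_fun in_setI in_setD; case: (g \in B); case: (g \in C) => //=.
all: by rewrite ?mulr0 ?addr0// mulr1 subrr.
Qed.

Lemma cylinder_span_indicU B C : cylinder_span (ind B) ->
  cylinder_span (ind C) -> cylinder_span (ind (B `|` C)).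
Proof.
move=> sB sC; have := cylinder_spanD sC (cylinder_span_indicD sB sC).
congr cylinder_span; apply/funext => g.
transitivity (ind C g + ind (B `\` C) g : R) => //.
rewrite /indic_fun in_setU in_setD.
by case: (g \in B); case: (g \in C); rewrite //= ?addr0 ?add0r.
Qed.

Lemma cylinder_span_basic B : basic_sets B -> cylinder_span (ind B).
Proof.
move=> [mu [nu [S [[pm pn] mn fS Sm ->]]]].
have cmn : coterminal mu nu by [].
apply: cylinder_span_indicD; first exact: cylinder_span_cylinder.
rewrite -(bigsetU_fset_set _ fS).
have : {in enum_fset (fset_set S), forall al, finite_path E al /\ fpath_rng al = fpath_src mu}.
  by move=> al; rewrite in_fset_set// inE => /Sm.
elim: (enum_fset _) => [|al l IH] lm.
  by rewrite big_nil indic_fun0; exact: cylinder_span0.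
rewrite big_cons; apply: cylinder_span_indicU.
  have [pa am] := lm al (mem_head _ _).
  by apply: cylinder_span_cylinder; exact: coterminal_cat.
by apply: IH => be bl; apply: lm; rewrite inE bl orbT.
Qed.

Lemma indic_cylinder_steinberg mu nu : coterminal mu nu ->
  steinberg_fun R G (ind (cylinder mu nu)).
Proof.
move=> cmn; have cC := cylinder_closed cmn; have oC := cylinder_open cmn.
split=> [g|].
  have [gC|gC] := boolP (g \in cylinder mu nu).
    have : nbhs g (cylinder mu nu).
      by apply: open_nbhs_nbhs; split=> //; rewrite inE in gC.
    by apply: filterS => h hC; rewrite /indic_fun gC mem_set.
  have : nbhs g (~` cylinder mu nu).
    apply: open_nbhs_nbhs; split; first exact: closed_openC.
    by rewrite notin_setE in gC.
  apply: filterS => h hC; rewrite /indic_fun (negbTE gC).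
  by rewrite (_ : h \in _ = false)//; apply/negbTE; rewrite notin_setE.
apply: (subclosed_compact _ (cylinder_compact cmn)).
  exact: closed_closure.
rewrite /tsupport [X in _ `<=` X](iffLR (closure_id _) cC).
apply: closureS => g /=; rewrite /indic_fun; case: (boolP (g \in _)).
  by rewrite inE.
by rewrite eqxx.
Qed.

Lemma cylinder_span_steinberg f : cylinder_span f -> f \in steinberg_pred R G.
Proof.
have [s0 sD] := @steinberg_submod_closed R G.
elim=> [|k mu nu h cmn _ IH]; first exact: s0.
by apply: sD => //; apply: mem_set; exact: indic_cylinder_steinberg.
Qed.

Lemma steinberg_cylinder_span f : steinberg_fun R G f -> cylinder_span f.
Proof.
move=> [lf cf].
have /choice[B BP] g : exists B, [/\ basic_sets B, B g &
    B `<=` [set h | f h = f g]].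
  exact: nbhs_basic (lf g).
have [g _|D Dcov] := compact_finite_subcover (U := B) cf.
  have [bB Bg _] := BP g.
  by apply: open_nbhs_nbhs; split=> //; exact: basic_open.
set U := \big[_/_]_(_ <- D) _ in Dcov.
(* f vanishes off the union U of finitely many basic sets. *)
have cover0 g : ~ U g -> f g = 0.
  move=> ng; apply: contrapT => /eqP fg; apply: ng; apply: Dcov.
  exact: subset_closure.
rewrite (_ : f = pointwise_mul f (ind U)); last first.
  apply/funext => g; rewrite /pointwise_mul /indic_fun; have [|/negP gD] := boolP (g \in _).
    by rewrite mulr1.
  by rewrite mulr0 cover0// => ?; apply: gD; rewrite inE.
rewrite {cover0 Dcov}/U {U}; elim: D => [|g l IH].
  rewrite big_nil indic_fun0 (_ : pointwise_mul _ _ = 0); first exact: cylinder_span0.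
  by apply/funext => h; exact: mulr0.
rewrite big_cons; set U := \big[_/_]_(_ <- l) _ in IH *.
have IU : cylinder_span (ind U).
  rewrite /U {IH U}; elim: l => [|i l IH].
    by rewrite big_nil indic_fun0; exact: cylinder_span0.
  rewrite big_cons; apply: cylinder_span_indicU => //.
  by have [bB _ _] := BP i; exact: cylinder_span_basic.
have [bB _ Bf] := BP g.
(* On B g, where f is constant, keep only the points not in U. *)
have := cylinder_spanD IH (cylinder_spanZ (f g)
  (cylinder_span_indicD (cylinder_span_basic bB) IU)).
congr cylinder_span; apply/funext => h.
transitivity (f h * ind U h + f g * ind (B g `\` U) h : R) => //.
rewrite /pointwise_mul /indic_fun in_setU in_setD.
have [/set_mem/Bf /= <-|] := boolP (h \in B g); last first.
  by rewrite !mulr0 addr0.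
by case: (h \in U); rewrite /= ?mulr0 ?addr0 ?add0r.
Qed.

End cylinder_span.

(** * A filtration of the Leavitt path algebra *)

Section nu_algebra_theory.
Variables (R : comPzRingType) (A : nuAlgType R).
Implicit Types x y : A.

Lemma numul0l x : 0 ** x = 0.
Proof. by rewrite -[in LHS](scale0r (0 : A)) numulZl scale0r. Qed.

Lemma numul0r x : x ** 0 = 0.
Proof. by rewrite -[in LHS](scale0r (0 : A)) numulZr scale0r. Qed.

Lemma numul_suml I (r : seq I) (P : pred I) (F : I -> A) x :
  (\sum_(i <- r | P i) F i) ** x = \sum_(i <- r | P i) F i ** x.
Proof.
by apply: (big_morph (fun y => y ** x)) => [y z|]; rewrite ?numulDl ?numul0l.
Qed.

Lemma numul_sumr I (r : seq I) (P : pred I) (F : I -> A) x :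
  x ** (\sum_(i <- r | P i) F i) = \sum_(i <- r | P i) x ** F i.
Proof.
by apply: (big_morph (fun y => x ** y)) => [y z|]; rewrite ?numulDr ?numul0r.
Qed.

End nu_algebra_theory.

(** Collecting equal terms in a linear combination given by a list. *)
Lemma sum_collect (R : comPzRingType) (V : lmodType R) (T : eqType)
    (l : seq (R * T)) (F : T -> V) :
  \sum_(i <- l) i.1 *: F i.2 =
  \sum_(a <- undup (map snd l)) (\sum_(i <- l | i.2 == a) i.1) *: F a.
Proof.
under [RHS]eq_bigr do rewrite scaler_suml big_mkcond.
rewrite exchange_big /=; apply: eq_big_seq => i il.
have il' : i.2 \in undup (map snd l) by rewrite mem_undup map_f.
rewrite (bigD1_seq i.2) ?undup_uniq//= eqxx big1 ?addr0// => a.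
by rewrite eq_sym => /negbTE ->.
Qed.

Section leavitt_span.
Variables (R : comPzRingType) (E : digraph).
Local Notation L := (leavitt_path_algebra R E).
Local Notation p := (lpa_p R).
Local Notation s := (lpa_s R).
Local Notation t := (lpa_t R).
Implicit Types (v w : vertex E) (e f : edge E) (l : seq (edge E)).
Implicit Types (mu nu : fpath E) (x y : L).

Lemma lpa_pp v w : p v ** p w = if v == w then p v else 0 :> L.
Proof. by case: (lpa_leavitt_family R E) => H _ _ _ _; exact: H. Qed.

Lemma lpa_ps e : p (rng e) ** s e = s e :> L.
Proof. by case: (lpa_leavitt_family R E) => _ H _ _ _; case: (H e). Qed.

Lemma lpa_pt e : p (src e) ** t e = t e :> L.
Proof. by case: (lpa_leavitt_family R E) => _ _ H _ _; case: (H e). Qed.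

Lemma lpa_tp e : t e ** p (rng e) = t e :> L.
Proof. by case: (lpa_leavitt_family R E) => _ _ H _ _; case: (H e). Qed.

Lemma lpa_sp e : s e ** p (src e) = s e :> L.
Proof. by case: (lpa_leavitt_family R E) => _ H _ _ _; case: (H e). Qed.

Lemma lpa_ts e f : t e ** s f = if e == f then p (src e) else 0 :> L.
Proof. by case: (lpa_leavitt_family R E) => _ _ _ H _; exact: H. Qed.

Lemma lpa_pE v : received v !=set0 -> finite_set (received v) ->
  p v = \sum_(e \in received v) s e ** t e :> L.
Proof. by case: (lpa_leavitt_family R E) => _ _ _ _ H; exact: H. Qed.

(** The product [s e1 ** ... ** s en ** p (src en)] along a list of edges; it is
[p v] for the empty list, and [v] plays no role otherwise. *)
Fixpoint lpa_real_from v l : L :=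
  if l is e :: l' then s e ** lpa_real_from (src e) l' else p v.

(** The product [p (src en) ** t en ** ... ** t e1], with the same convention. *)
Fixpoint lpa_ghost_from v l : L :=
  if l is e :: l' then lpa_ghost_from (src e) l' ** t e else p v.

(** The element of the algebra given by a finite path. *)
Definition lpa_real mu := lpa_real_from mu.1 mu.2.
(** The element given by the ghost of a finite path. *)
Definition lpa_ghost nu := lpa_ghost_from nu.1 nu.2.

Lemma lpa_p_ghost v nu :
  p v ** lpa_ghost nu = if v == fpath_src nu then lpa_ghost nu else 0.
Proof.
case: nu => w l; rewrite /lpa_ghost /fpath_src /=.
elim: l w => [|e l IH] w /=; first by rewrite lpa_pp; case: eqVneq => [->|].
by rewrite numulA IH; case: ifP => // _; rewrite numul0l.
Qed.

Lemma lpa_ghost_rcons e w l : rng e = last w (map src l) ->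
  t e ** lpa_ghost_from w l = lpa_ghost_from w (rcons l e).
Proof.
elim: l w => [|f l IH] w /= re; first by rewrite -re lpa_tp lpa_pt.
by rewrite numulA IH.
Qed.

Lemma lpa_t_ghost e nu : t e ** lpa_ghost nu =
  if rng e == fpath_src nu then lpa_ghost (nu.1, rcons nu.2 e) else 0.
Proof.
rewrite -lpa_tp -numulA lpa_p_ghost; case: eqP => [re|_].
  exact: lpa_ghost_rcons.
by rewrite numul0r.
Qed.

(** The filtration of the Leavitt path algebra by the lengths of the real paths:
level [0] is the span of the ghost paths, and level [n.+1] is spanned by the
ghost paths and the [s e ** y] with [y] of level [n]. *)
Inductive lpa_depth : nat -> L -> Prop :=
  | lpa_depth0 n : lpa_depth n 0
  | lpa_depthG n a nu x : finite_path E nu -> lpa_depth n x ->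
      lpa_depth n (a *: lpa_ghost nu + x)
  | lpa_depthS n e y x : lpa_depth n y -> lpa_depth n.+1 x ->
      lpa_depth n.+1 (s e ** y + x).

Lemma lpa_depthD n x y : lpa_depth n x -> lpa_depth n y -> lpa_depth n (x + y).
Proof.
elim=> {n x} [n|n a nu x pn _ IH|n e z x dz _ _ IH] dy.
- by rewrite add0r.
- by rewrite -addrA; apply: lpa_depthG => //; exact: IH.
- by rewrite -addrA; apply: lpa_depthS => //; exact: IH.
Qed.

Lemma lpa_depthZ n a x : lpa_depth n x -> lpa_depth n (a *: x).
Proof.
elim=> {n x} [n|n b nu x pn _ IH|n e z x _ dz _ IH].
- by rewrite scaler0; exact: lpa_depth0.
- by rewrite scalerDr scalerA; exact: lpa_depthG.
- by rewrite scalerDr -numulZr; exact: lpa_depthS.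
Qed.

Lemma lpa_depth_ghost n nu : finite_path E nu -> lpa_depth n (lpa_ghost nu).
Proof.
move=> pn; rewrite -[lpa_ghost nu]addr0 -[lpa_ghost nu]scale1r.
by apply: lpa_depthG => //; exact: lpa_depth0.
Qed.

Lemma lpa_depth_s n e y : lpa_depth n y -> lpa_depth n.+1 (s e ** y).
Proof.
move=> dy; rewrite -[_ ** _]addr0.
by apply: lpa_depthS => //; exact: lpa_depth0.
Qed.

Lemma lpa_depth_le m n x : lpa_depth n x -> (n <= m)%N -> lpa_depth m x.
Proof.
move=> dx; elim: dx m => {n x} [n|n a nu x pn _ IH|n e z x _ IHz _ IH] m nm.
- exact: lpa_depth0.
- by apply: lpa_depthG => //; exact: IH.
- by case: m nm => // m nm; apply: lpa_depthS; [exact: IHz|exact: IH].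
Qed.

Lemma lpa_depth_p n v x : lpa_depth n x -> lpa_depth n (p v ** x).
Proof.
elim=> {n x} [n|n a nu x pn _ IH|n e z x dz _ _ IH].
- by rewrite numul0r; exact: lpa_depth0.
- rewrite numulDr numulZr lpa_p_ghost; case: ifP => _.
    exact: lpa_depthG.
  by rewrite scaler0 add0r.
- rewrite numulDr numulA -[s e]lpa_ps numulA lpa_pp; case: eqP => [ve|_].
    by rewrite {1}ve lpa_ps; exact: lpa_depthS.
  by rewrite !numul0l add0r.
Qed.

Lemma lpa_depth_t n e x : lpa_depth n x -> lpa_depth n.-1 (t e ** x).
Proof.
elim=> {n x} [n|n a nu x pn _ IH|n f z x dz _ _ IH].
- by rewrite numul0r; exact: lpa_depth0.
- rewrite numulDr numulZr lpa_t_ghost; case: eqP => [re|_].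
    by apply: lpa_depthG => //; apply/path_from_rcons.
  by rewrite scaler0 add0r.
- rewrite numulDr numulA lpa_ts; case: eqP => [_|_] /=.
    by apply: lpa_depthD IH; exact: lpa_depth_p.
  by rewrite numul0l add0r.
Qed.

(** Every element has a level. The induction on terms also proves that left
multiplication by the element preserves the union of the levels, which is what
products require. *)
Lemma lpa_depth_exists x : exists n, lpa_depth n x.
Proof.
suff [//] : (exists n, lpa_depth n x) /\
  (forall n y, lpa_depth n y -> exists m, lpa_depth m (x ** y)).
elim/lpa_ind: x; elim=> [v|e|e||a [[n da] IHa] b [[m db] IHb]|a [[n da] IHa]
    |k a [[n da] IHa]|a [[n da] IHa] b [[m db] IHb]].
- split; first by exists 0%N; exact: (@lpa_depth_ghost _ (vpath v)).
  by move=> n y /(lpa_depth_p v) dy; exists n.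
- split; last by move=> n y /(lpa_depth_s e) dy; exists n.+1.
  exists 1%N; rewrite -/(lpa_s R e) -lpa_sp; apply: lpa_depth_s.
  exact: (@lpa_depth_ghost _ (vpath (src e))).
- split; last by move=> n y /(lpa_depth_t e) dy; exists n.-1.
  exists 0%N; rewrite -/(lpa_t R e) -lpa_pt.
  exact: (@lpa_depth_ghost _ (epath e)).
- rewrite lpa_class0; split; first by exists 0%N; exact: lpa_depth0.
  by move=> n y _; exists 0%N; rewrite numul0l; exact: lpa_depth0.
- have add x y n1 m1 : lpa_depth n1 x -> lpa_depth m1 y ->
      exists k, lpa_depth k (x + y).
    move=> dx dy; exists (maxn n1 m1); apply: lpa_depthD.
      by apply: lpa_depth_le dx _; rewrite leq_maxl.
    by apply: lpa_depth_le dy _; rewrite leq_maxr.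
  rewrite lpa_classD; split; first exact: add da db.
  move=> k y dy; rewrite numulDl.
  by have [? da'] := IHa _ _ dy; have [? db'] := IHb _ _ dy; exact: add da' db'.
- rewrite lpa_classN -scaleN1r; split; first by exists n; exact: lpa_depthZ.
  by move=> k y /IHa[m dm]; exists m; rewrite numulZl; exact: lpa_depthZ.
- rewrite lpa_classZ; split; first by exists n; exact: lpa_depthZ.
  by move=> m y /IHa[j dm]; exists j; rewrite numulZl; exact: lpa_depthZ.
- rewrite lpa_classM; split; first exact: IHa db.
  by move=> k y /IHb[j /IHa[i di]]; exists i; rewrite -numulA.
Qed.

(** An element of level [n] is the sum of a combination of ghost paths and of
elements [s e ** y], the latter being absent in level [0]. *)
Lemma lpa_depth_split n x : lpa_depth n x ->
  exists (l : seq (R * fpath E)) (k : seq (edge E * L)),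
  [/\ forall i, i \in l -> finite_path E i.2, n = 0%N -> k = [::] &
      x = \sum_(i <- l) i.1 *: lpa_ghost i.2 + \sum_(i <- k) s i.1 ** i.2].
Proof.
elim=> {n x} [n|n a nu x pn _ [l [k [pl nk ->]]]|n e y x dy _ _ [l [k [pl nk ->]]]].
- by exists [::], [::]; split=> //; rewrite !big_nil addr0.
- exists ((a, nu) :: l), k; split=> //; last by rewrite big_cons addrA.
  by move=> i; rewrite inE => /orP[/eqP->|/pl].
- exists l, ((e, y) :: k); split=> //.
  by rewrite big_cons addrCA.
Qed.

(** Large enough finite sums of vertices act as a left unit on a given
element. *)
Lemma lpa_depth_local_unit n x : lpa_depth n x -> exists V : seq (vertex E),
  forall W, uniq W -> {subset V <= W} -> (\sum_(v <- W) p v) ** x = x.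
Proof.
have unit v W y : uniq W -> v \in W -> p v ** y = y ->
    (\sum_(w <- W) p w) ** y = y.
  move=> uW vW vy; rewrite numul_suml (bigD1_seq v)//= vy big1 ?addr0// => w.
  by rewrite -vy numulA lpa_pp => /negbTE ->; rewrite numul0l.
elim=> {n x} [n|n a nu x pn _ [V VP]|n e y x _ _ _ [V VP]].
- by exists [::] => W _ _; rewrite numul0r.
- exists (fpath_src nu :: V) => W uW VW.
  rewrite numulDr numulZr VP//; last first.
    by move=> v vV; apply: VW; rewrite inE vV orbT.
  rewrite (unit (fpath_src nu))//; first by apply: VW; exact: mem_head.
  by rewrite lpa_p_ghost eqxx.
- exists (rng e :: V) => W uW VW.
  rewrite numulDr VP//; last by move=> v vV; apply: VW; rewrite inE vV orbT.
  rewrite (unit (rng e))//; first by apply: VW; exact: mem_head.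
  by rewrite numulA lpa_ps.
Qed.

Lemma lpa_eq0 x : (forall v, p v ** x = 0) -> x = 0.
Proof.
move=> x0; have [n /lpa_depth_local_unit[V VP]] := lpa_depth_exists x.
rewrite -(VP (undup V)) ?undup_uniq//; last by move=> v; rewrite mem_undup.
by rewrite numul_suml big1.
Qed.

End leavitt_span.

(** * The isomorphism *)

Section graph_family.
Variables (R : comPzRingType) (E : digraph).
Local Notation G := (graph_groupoid E).
Local Notation ind := (indic_fun R).
Local Notation A := (row_finite R G).
Implicit Types (v w : vertex E) (e f : edge E) (l : seq (edge E)).
Implicit Types (mu nu : fpath E).

(** The characteristic function of a cylinder, as an element of [row_finite]. *)
Definition cylinder_row_finite mu nu (pm : finite_path E mu) : A :=
  RowFinite (mem_set (indic_row_finite R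
    (@cylinder_rng_injective E mu nu pm))).

(** The images of the generators [p v], [s e] and [t e]. *)
Definition graph_p v : A :=
  @cylinder_row_finite (vpath v) (vpath v) (finite_vpath v).
Definition graph_s e : A :=
  @cylinder_row_finite (epath e) (vpath (src e)) (finite_epath e).
Definition graph_t e : A :=
  @cylinder_row_finite (vpath (src e)) (epath e) (finite_vpath (src e)).

Lemma cylinder_row_finiteM mu nu mu' nu'
    (pm : finite_path E mu) (pm' : finite_path E mu') :
  row_finite_val (cylinder_row_finite nu pm ** cylinder_row_finite nu' pm') =
  ind (set_gmul (cylinder mu nu) (cylinder mu' nu')).
Proof.
rewrite row_finite_valM /= convolution_indic//.
exact: cylinder_rng_injective.
Qed.

Lemma coterminal_vpath v : coterminal (vpath v) (vpath v).
Proof. by []. Qed.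

Lemma coterminal_epath e : coterminal (epath e) (vpath (src e)).
Proof. by []. Qed.

Lemma coterminal_epathV e : coterminal (vpath (src e)) (epath e).
Proof. by []. Qed.

Lemma coterminal_epath2 e : coterminal (epath e) (epath e).
Proof. by []. Qed.

Hint Resolve coterminal_vpath coterminal_epath coterminal_epathV
  coterminal_epath2 : core.

Lemma epath_cat_inj e f (x y : gpath E) :
  gpath_cat (epath e) x = gpath_cat (epath f) y -> e = f.
Proof.
by case: x y => [[v l]|x] [[w m]|y] //= [] => [_ -> _|/(congr1 (@^~ 0%N))].
Qed.

Lemma cylinder_epath_sub e :
  cylinder (epath e) (epath e) `<=` cylinder (vpath (rng e)) (vpath (rng e)).
Proof. exact: (@cylinder_cat _ (vpath (rng e)) (vpath (rng e)) (epath e)). Qed.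

Lemma graph_family : leavitt_family graph_p graph_s graph_t.
Proof.
split=> [v w|e|e|e f|v v0 fv].
- apply: row_finite_val_inj; rewrite cylinder_row_finiteM.
  case: eqVneq => [<-|vw].
    by rewrite cylinder_mul.
  by rewrite cylinder_mul0_rng// indic_fun0.
- split; apply: row_finite_val_inj; rewrite cylinder_row_finiteM.
    by have -> := @cylinder_mulr _ (vpath (rng e)) (vpath (rng e)) (epath e).
  by rewrite cylinder_mul.
- split; apply: row_finite_val_inj; rewrite cylinder_row_finiteM.
    by rewrite cylinder_mul.
  by have -> := @cylinder_mull _ _ (vpath (rng e)) (epath e) (vpath (rng e)).
- apply: row_finite_val_inj; rewrite cylinder_row_finiteM.
  case: eqVneq => [<-|ef].
    by rewrite cylinder_mul.
  rewrite cylinder_mul0 ?indic_fun0// => x y _ _ _ _ /epath_cat_inj fe.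
  by rewrite fe eqxx in ef.
apply: row_finite_val_inj; rewrite fsbig_finite// row_finite_val_sum.
rewrite fct_sumE; apply/funext => g.
under eq_bigr do rewrite cylinder_row_finiteM cylinder_mul//.
(* At g, the sum has at most one nonzero term, the one of the first edge of the
   range of g. *)
have [gv|gv] := boolP (g \in cylinder (vpath v) (vpath v)); last first.
  rewrite /= /indic_fun (negbTE gv) big1_seq// => e /=.
  rewrite in_fset_set// inE /received/= => ev.
  suff -> : g \in cylinder (epath e) (epath e) = false by [].
  apply: contraNF gv; rewrite !inE -ev; exact: cylinder_epath_sub.
rewrite /= /indic_fun gv.
move: gv; rewrite inE => -[x [bx vx gE]].
have [xE|[e [y [By ey xE]]]] := boundary_pathP bx.
  (* The range of g has a first edge, as v receives edges, but finitely many. *)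
  move: bx; rewrite xE -vx => /singular_vpath[vs|//].
  by move: v0; rewrite /is_source in vs; rewrite vs => -[].
have xv : gpath_cat (vpath v) x = x by rewrite boundary_path_vertex_cat// vx.
have ev : e \in fset_set (received v).
  by rewrite in_fset_set// inE /received/= (_ : v = gpath_rng x)// xE gpath_rng_cat.
rewrite (bigD1_seq e) ?fset_uniq//= big1 => [|f fe].
  rewrite addr0 mem_set//; exists y; split=> //.
  by rewrite gE xv -xE !subrr.
suff -> : g \in cylinder (epath f) (epath f) = false by [].
apply: contraNF fe; rewrite inE => -[z [_ _]]; rewrite gE xv xE => -[+ _].
by move=> /epath_cat_inj ->; rewrite eqxx.
Qed.

Local Notation L := (leavitt_path_algebra R E).

(** The homomorphism given by the universal property. *)
Definition graph_lift : L -> A := lpa_lift graph_p graph_s graph_t.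

HB.instance Definition _ := GRing.isLinear.Build R L A _ graph_lift
  (lpa_lift_linear graph_family).

Lemma graph_liftM : {morph graph_lift : x y / x ** y}.
Proof.
by do 2![elim/lpa_ind => ?]; rewrite -lpa_classM /graph_lift !(lpa_liftE graph_family).
Qed.

Lemma graph_lift_p v : graph_lift (lpa_p R v) = graph_p v.
Proof. exact: (lpa_liftE graph_family). Qed.

Lemma graph_lift_s e : graph_lift (lpa_s R e) = graph_s e.
Proof. exact: (lpa_liftE graph_family). Qed.

Lemma graph_lift_t e : graph_lift (lpa_t R e) = graph_t e.
Proof. exact: (lpa_liftE graph_family). Qed.

Lemma graph_lift_real mu : finite_path E mu ->
  row_finite_val (graph_lift (lpa_real R mu)) =
  ind (cylinder mu (vpath (fpath_src mu))).
Proof.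
case: mu => v l; rewrite /lpa_real /finite_path /=.
elim: l v => [|e l IH] v /=; first by rewrite graph_lift_p.
move=> [<- pl]; rewrite graph_liftM row_finite_valM IH// graph_lift_s /=.
rewrite convolution_indic; last exact: cylinder_rng_injective.
by have -> := @cylinder_mulr _ (epath e) (vpath (src e)) (src e, l)
  (vpath (fpath_src (rng e, e :: l))).
Qed.

Lemma graph_lift_ghost nu : finite_path E nu ->
  row_finite_val (graph_lift (lpa_ghost R nu)) =
  ind (cylinder (vpath (fpath_src nu)) nu).
Proof.
case: nu => v l; rewrite /lpa_ghost /finite_path /=.
elim: l v => [|e l IH] v /=; first by rewrite graph_lift_p.
move=> [<- pl]; rewrite graph_liftM row_finite_valM IH// graph_lift_t /=.
rewrite convolution_indic; last exact: cylinder_rng_injective.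
by have -> := @cylinder_mull _ (vpath (fpath_src (rng e, e :: l)))
  (vpath (src e)) (src e, l) (epath e).
Qed.

(** The products of a path and a ghost path are mapped to the cylinders. *)
Lemma graph_lift_mono mu nu : coterminal mu nu ->
  row_finite_val (graph_lift (lpa_real R mu ** lpa_ghost R nu)) =
  ind (cylinder mu nu).
Proof.
move=> [pm pn mn].
rewrite graph_liftM row_finite_valM graph_lift_real// graph_lift_ghost//.
rewrite convolution_indic; last exact: cylinder_rng_injective.
by rewrite -mn cylinder_mul//; split=> //; rewrite -mn.
Qed.

Lemma cylinder_span_lift (f : G -> R^o) : cylinder_span f ->
  exists x, row_finite_val (graph_lift x) = f.
Proof.
elim=> [|k mu nu {}f cmn _ [x <-]]; first by exists 0; rewrite linear0.
exists (k *: (lpa_real R mu ** lpa_ghost R nu) + x).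
by rewrite linearP -graph_lift_mono.
Qed.

Lemma cylinder_span_s e (f : G -> R^o) : cylinder_span f ->
  cylinder_span (convolution (row_finite_val (graph_s e)) f).
Proof.
elim=> [|k mu nu {}f cmn _ IH].
  rewrite (_ : convolution _ _ = 0); first exact: cylinder_span0.
  by have /(congr1 val) := numul0r (graph_s e).
rewrite convolutionDr; last exact: row_finiteP.
apply: cylinder_spanD IH; rewrite convolutionZr; last exact: row_finiteP.
apply: cylinder_spanZ; rewrite /= convolution_indic; last first.
  exact: cylinder_rng_injective.
have [pm pn mn] := cmn.
have [ev|ev] := eqVneq (src e) (fpath_rng mu); last first.
  by rewrite cylinder_mul0_rng// indic_fun0; exact: cylinder_span0.
rewrite -[in X in set_gmul _ X](vpath_cat mu) -ev cylinder_mulr//; last first.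
  by rewrite ev vpath_cat.
apply: cylinder_span_cylinder; split=> //.
  exact: finite_path_cat.
by rewrite fpath_src_cat.
Qed.

Lemma lift_cylinder_span (x : L) : cylinder_span (row_finite_val (graph_lift x)).
Proof.
have [n] := lpa_depth_exists x.
elim=> {n x} [n|n a nu x pn _ IH|n e y x dy IHy _ IH].
- by rewrite linear0; exact: cylinder_span0.
- rewrite linearP /= graph_lift_ghost//; apply: cylinder_spanC => //.
- rewrite linearD /= graph_liftM graph_lift_s; apply: cylinder_spanD IH.
  exact: cylinder_span_s.
Qed.

Lemma graph_lift_valD (x y : L) g : row_finite_val (graph_lift (x + y)) g =
  row_finite_val (graph_lift x) g + row_finite_val (graph_lift y) g.
Proof. by rewrite linearD. Qed.

(** An arrow of range [z] and source [nu z], of degree minus the length of [nu],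
belongs to the cylinder of no ghost path but [nu]. *)
Lemma cylinder_ghostP nu nu' (z : gpath E) (g : G) :
  finite_path E nu -> finite_path E nu' -> boundary_path E z ->
  fpath_src nu = gpath_rng z ->
  gg_val g = (z, - (fpath_len nu)%:Z, gpath_cat nu z) ->
  cylinder (vpath (fpath_src nu')) nu' g <-> nu' = nu.
Proof.
move=> pn pn' bz nz gE; split=> [[x [bx nx]]|->]; last first.
  exists z; split=> //.
  by rewrite gE boundary_path_vertex_cat// add0r.
rewrite boundary_path_vertex_cat// gE => -[zx len cat].
have le : (fpath_len nu <= fpath_len nu')%N by move: len; rewrite /=; lia.
have [la [_ _ nuE _]] := gpath_cat_prefix pn pn' nz nx cat le.
have la0 : la.2 = [::].
  apply: size0nil; rewrite -[size _]/(fpath_len la).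
  move: len; rewrite (_ : fpath_len (vpath _) = 0%N)// nuE fpath_len_cat; lia.
by rewrite nuE /fpath_cat la0 cats0; case: (nu).
Qed.

(** The coefficient of [nu] in a combination of ghost paths is the value of its
image at the arrow of range [z] and source [nu z], for any boundary path [z]
whose range is the source [v] of [nu]. *)
Lemma lift_ghost_sum_eq0 v (z : gpath E) (l : seq (R * fpath E)) :
  boundary_path E z -> gpath_rng z = v ->
  (forall i, i \in l -> finite_path E i.2) ->
  (forall g : G, g.1.1 = z ->
    row_finite_val (graph_lift (\sum_(i <- l) i.1 *: lpa_ghost R i.2)) g = 0) ->
  lpa_p R v ** (\sum_(i <- l) i.1 *: lpa_ghost R i.2) = 0.
Proof.
move=> bz zv pl vanish.
rewrite numul_sumr; under eq_bigr do rewrite numulZr.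
rewrite (sum_collect l (fun nu => lpa_p R v ** lpa_ghost R nu)).
apply: big1_seq => nu /=; rewrite mem_undup => /mapP[i il nuE].
have pn : finite_path E nu by rewrite nuE; exact: pl.
rewrite lpa_p_ghost; case: eqP => [vn|_]; last by rewrite scaler0.
suff -> : \sum_(j <- l | j.2 == nu) j.1 = 0 by rewrite scale0r.
have nz : fpath_src nu = gpath_rng z by rewrite zv.
have [||g _ gE] := @cylinder_elt _ (vpath v) nu z _ bz; rewrite -?zv//.
have gE' : gg_val g = (z, - (fpath_len nu)%:Z, gpath_cat nu z).
  by rewrite gE boundary_path_vertex_cat ?zv// add0r.
have := vanish g; rewrite gE => /(_ (boundary_path_vertex_cat (esym zv))).
rewrite linear_sum row_finite_val_sum fct_sumE; apply: etrans.
rewrite big_mkcond; apply: eq_big_seq => j jl /=.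
rewrite linearZ.
transitivity (j.1 * row_finite_val (graph_lift (lpa_ghost R j.2)) g : R) => //.
rewrite graph_lift_ghost; last exact: pl.
rewrite /indic_fun; have := cylinder_ghostP pn (pl _ jl) bz nz gE'.
case: eqP => [jn|jn] H; last first.
  suff -> : g \in cylinder (vpath (fpath_src j.2)) j.2 = false by rewrite mulr0.
  by apply/negP; rewrite inE => /H.
by rewrite mem_set ?mulr1//; apply/H.
Qed.

(** The image of [s e ** y] is supported on arrows whose range starts with
[e]. *)
Lemma lift_s_vanish e (y : L) (g : G) v : g.1.1 = Fin (vpath v) ->
  row_finite_val (graph_lift (lpa_s R e ** y)) g = 0.
Proof.
move=> gv; rewrite graph_liftM row_finite_valM graph_lift_s.
apply/eqP; apply: contraPT gv => sy.
have [a [b [[_ sa] [ba _] gE]]] := row_support_convolution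
  (row_finiteP (graph_s e) _) sy.
have [x [_ _ aE]] : cylinder (epath e) (vpath (src e)) a.
  move: sa; rewrite /= /indic_fun; case: (boolP (a \in _)); rewrite ?inE//.
  by rewrite eqxx.
rewrite gE gmul_val// aE /=.
by case: x {aE} => [[w m]|x].
Qed.

Lemma regular_eq0 v (x : L) : received v !=set0 -> finite_set (received v) ->
  (forall e, lpa_t R e ** x = 0) -> lpa_p R v ** x = 0.
Proof.
move=> v0 fv tx; rewrite lpa_pE// fsbig_finite// numul_suml big1// => e _.
by rewrite -numulA tx numul0r.
Qed.

(** The finite sum of the [s e ** t e], for [e] of range [v] occurring in [k],
fixes [p v ** x] and annihilates it. *)
Lemma edge_sum_eq0 v (x : L) (k : seq (edge E * L)) :
  (forall e, lpa_t R e ** x = 0) ->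
  lpa_p R v ** x = lpa_p R v ** (\sum_(i <- k) lpa_s R i.1 ** i.2) ->
  lpa_p R v ** x = 0.
Proof.
move=> tx xE.
pose F := undup [seq e <- map fst k | rng e == v].
have Fv e : e \in F -> rng e = v by rewrite mem_undup mem_filter => /andP[/eqP].
have : (\sum_(e <- F) lpa_s R e ** lpa_t R e) ** (lpa_p R v ** x) = 0.
  rewrite numul_suml; apply: big1_seq => e /= /Fv <-.
  by rewrite -numulA (numulA (lpa_t R e)) lpa_tp tx numul0r.
suff -> : (\sum_(e <- F) lpa_s R e ** lpa_t R e) ** (lpa_p R v ** x) =
  lpa_p R v ** x by [].
rewrite xE numul_sumr numul_sumr; apply: eq_big_seq => i ik.
rewrite (numulA (lpa_p R v)); have [iv|iv] := eqVneq (rng i.1) v; last first.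
  rewrite -[lpa_s R i.1]lpa_ps (numulA (lpa_p R v)) lpa_pp eq_sym (negbTE iv).
  by rewrite !numul0l numul0r.
rewrite -iv lpa_ps numulA numul_suml (bigD1_seq i.1) ?undup_uniq//=; last first.
  by rewrite mem_undup mem_filter iv eqxx map_f.
rewrite -numulA lpa_ts eqxx lpa_sp big1 ?addr0// => f /negbTE fi.
by rewrite -numulA lpa_ts fi numul0r.
Qed.

Lemma graph_lift_inj_depth n (x : L) : lpa_depth n x -> graph_lift x = 0 -> x = 0.
Proof.
elim: n x => [|n IH] x dx x0; apply: lpa_eq0 => v;
    have [l [k [pl nk xE]]] := lpa_depth_split dx.
  rewrite xE (nk erefl) big_nil addr0.
  have [z bz zv] := boundary_path_exists v.
  apply: (lift_ghost_sum_eq0 bz zv pl) => g _.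
  by move: xE; rewrite (nk erefl) big_nil addr0 => <-; rewrite x0.
have tx e : lpa_t R e ** x = 0.
  apply: IH; first exact: (lpa_depth_t e dx).
  by rewrite graph_liftM x0 numul0r.
have [[v0 fv]|sing] := pselect (received v !=set0 /\ finite_set (received v)).
  exact: regular_eq0.
have bv : boundary_path E (Fin (vpath v)).
  apply/singular_vpath; have [fv|] := pselect (finite_set (received v)).
    left; apply/seteqP; split=> // e ev; apply: sing; split=> //.
    by exists e.
  by right.
apply: (edge_sum_eq0 (k := k) tx).
rewrite {1}xE numulDr (@lift_ghost_sum_eq0 v (Fin (vpath v)) l) ?add0r// => g gv.
have : row_finite_val (graph_lift x) g = 0 by rewrite x0.
rewrite {1}xE graph_lift_valD.
suff -> : row_finite_val (graph_lift (\sum_(i <- k) lpa_s R i.1 ** i.2)) g = 0.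
  by rewrite addr0.
rewrite linear_sum row_finite_val_sum fct_sumE big1// => i _.
exact: lift_s_vanish gv.
Qed.

Lemma graph_lift_inj : injective graph_lift.
Proof.
move=> x y xy; apply/eqP; rewrite -subr_eq0; apply/eqP.
have [n dn] := lpa_depth_exists (x - y).
by apply: (graph_lift_inj_depth dn); rewrite linearB /= xy subrr.
Qed.

Lemma graph_lift_steinberg (x : L) :
  steinberg_pred R G (row_finite_val (graph_lift x)).
Proof. exact: cylinder_span_steinberg (lift_cylinder_span x). Qed.

(** The homomorphism [graph_lift], with values in the Steinberg algebra. *)
Definition graph_iso (x : L) : steinberg R G :=
  Steinberg (graph_lift_steinberg x).

Fact graph_iso_linear : linear graph_iso.
Proof.
move=> a x y; apply: val_inj.
transitivity (row_finite_val (graph_lift (a *: x + y))) => //.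
by rewrite linearP.
Qed.

HB.instance Definition _ := GRing.isLinear.Build R L (steinberg R G) _ graph_iso
  graph_iso_linear.

Lemma graph_iso_bij : bijective graph_iso.
Proof.
have iso_inj : injective graph_iso.
  by move=> x y /(congr1 val) xy; apply/graph_lift_inj/row_finite_val_inj.
have /choice[psi psiK] (f : steinberg R G) : exists x, graph_iso x = f.
  case: f => f sf.
  have [x xE] := cylinder_span_lift (steinberg_cylinder_span (set_mem sf)).
  by exists x; apply: val_inj.
by exists psi => // x; apply: iso_inj; rewrite psiK.
Qed.

End graph_family.

Theorem mainTheorem2 (E : digraph) (R : comPzRingType) :
  exists phi : {linear leavitt_path_algebra R E -> steinberg R (graph_groupoid E)},
    bijective phi /\
    forall x y : leavitt_path_algebra R E,
      steinberg_val (phi (x ** y)) = convolution (phi x) (phi y).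
Proof.
exists (@graph_iso R E); split; first exact: graph_iso_bij.
by move=> x y; rewrite /= graph_liftM row_finite_valM.
Qed.
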